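(* There exists $\ell_0\in\mathbb N$ such that for all $\ell>\ell_0$, $\mathrm{ex}(n,T^{\ell}_{4,7})=\Theta(n^{10/7})$.
   Context: $\mathrm{ex}(n,F)$ is the maximum number of edges in an $n$-vertex graph with no subgraph isomorphic to $F$. $T_{4,7}$ is the rooted tree obtained from a path $v_1v_2v_3v_4$ by attaching one new pendant leaf $r_i$ to each $v_i$ ($i=1,\dots,4$); it is rooted on $\{r_1,r_2,r_3,r_4\}$ (so it has $4$ non-root vertices and $7$ edges). For $\ell\in\mathbb N$, $T^\ell_{4,7}$ is the blow-up obtained from $\ell$ vertex-disjoint copies of $T_{4,7}$ by identifying, for each root $r_i$, the $\ell$ copies of $r_i$ into one vertex. *)

(* Defs.v *)
From mathcomp Require Import all_boot.
Set Implicit Arguments. Unset Strict Implicit. Unset Printing Implicit Defensive.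

(* A simple graph on vertex set 'I_n is encoded by a set E of ordered pairs;
   x,y are adjacent iff x <> y and (x,y) or (y,x) is in E.  Every simple graph
   on 'I_n arises this way. *)
Definition adj (n : nat) (E : {set 'I_n * 'I_n}) (x y : 'I_n) : bool :=
  (x != y) && (((x, y) \in E) || ((y, x) \in E)).

Definition num_edges (n : nat) (E : {set 'I_n * 'I_n}) : nat :=
  #|[set p : 'I_n * 'I_n | (p.1 < p.2)%N && adj E p.1 p.2]|.

Definition contains (n : nat) (E : {set 'I_n * 'I_n}) (V : finType) (F : rel V) : bool :=
  [exists f : {ffun V -> 'I_n},
     injectiveb f && [forall x, forall y, F x y ==> adj E (f x) (f y)]].

Definition ex (n : nat) (V : finType) (F : rel V) : nat :=
  \max_(E : {set 'I_n * 'I_n} | ~~ contains E F) num_edges E.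

(* The blow-up T^l_{4,7}: vertices are the 4 roots r_i (inl i) and, for each
   copy j < l, the path vertices v_i^j (inr (j, i)), i < 4.
   Edges: r_i -- v_i^j, and v_i^j -- v_{i+1}^j. *)
Definition Tblowup_V (l : nat) : finType := ('I_4 + ('I_l * 'I_4))%type.

Definition Tblowup (l : nat) : rel (Tblowup_V l) :=
  fun x y =>
    match x, y with
    | inl i, inr (_, k) => i == k
    | inr (_, k), inl i => i == k
    | inr (j, k), inr (j', k') =>
        (j == j') && ((k.+1 == k' :> nat) || (k'.+1 == k :> nat))
    | _, _ => false
    end.

(* Main.v *)
Require Import Defs.
From Stdlib Require Import Reals Lra.
From mathcomp Require all_boot all_algebra all_field zify ring mpoly.
Open Scope R_scope.

(* Upper bound. In a minimal counterexample one finds an almost regular subgraph of degree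
   about [C n^(3/7)]. Call a pair heavy if its codegree is at least a large constant [t]. Few
   2-paths have heavy ends, for otherwise T^l is found greedily; hence most of the
   [>= c C^7 n^4] copies of T are light, and some root tuple carries many of them. Fixing the
   roots and one path vertex of a light copy leaves at most [t^3] copies, so [l] disjoint ones
   can be chosen greedily.

   Lower bound. Take two copies of F_q^7 as vertex classes and join x to y when four random
   polynomials of bounded degree vanish at (x, y). Fix the four roots. The copies of T on them
   are the zeros of a system of 28 polynomials in 28 unknowns. Boundedly many zeros have a
   nonsingular Jacobian (Wooley's elementary form of Bezout's theorem). A singular zero costs an
   extra factor O(1/q): its Jacobian has at least q kernel vectors, and since T is balanced the
   expected number of pairs (zero, kernel vector) is bounded per root tuple. Values and
   directional derivatives of the random polynomials at distinct points being independent,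
   33 disjoint singular copies on a common root tuple occur with expected number less than 1.
   This replaces the Lang-Weil estimate of the usual random algebraic construction. *)

(** The exponent reflects the balance of T, 4 path vertices against 7 edges. With q^7 points on each
    side and edge probability q^-4, the host has about q^14 q^-4 = q^10 edges, and the expected
    number of copies on one root tuple is about q^28 q^-28, a constant. A constant expectation does
    not control the worst of the q^28 root tuples. A singular copy is rarer by a factor 1/q, so
    tuples of s singular copies with distinct edges have expected number about q^(28-s). One bad
    tuple may spoil all q^14 possible edges of an outcome, so keeping half of the q^10 expected
    edges requires q^(42-s) to be small against q^10. This is the origin of 33: an expectation below
    1 alone would not suffice. The nonsingular copies need a bound independent of q, and that bound
    determines l0. All counting is done in natural numbers, as bounds between ex^7 and n^10; seventh
    roots are taken only at the end. *)

Module Blowup.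
Import all_boot zify.
Close Scope R_scope.
Local Open Scope nat_scope.
Set Implicit Arguments. Unset Strict Implicit. Unset Printing Implicit Defensive.

(** * Upper bound *)

(* r lists the roots r_1, .., r_4 and [q j] the path vertices of the j-th copy. *)
Definition blowup_in (V : finType) (e : rel V) (l : nat) : Prop :=
  exists (r : seq V) (q : nat -> seq V),
    [/\ uniq r, size r = 4,
        forall j, j < l ->
          [/\ uniq (q j), all2 e r (q j), sorted e (q j) & ~~ has [in r] (q j)]
      & forall j k, j < k < l -> ~~ has [in q j] (q k)].

(** Greedy choice: the element of index k has to avoid only [size A + k] elements, fewer than
    [m + size A]. *)
Lemma sdr_avoid (V : finType) (x0 : V) (m : nat) (S : nat -> {set V}) (A : seq V) :
  (forall j, j < m -> m + size A <= #|S j|) ->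
  exists f : nat -> V, [/\ forall j, j < m -> f j \in S j,
    forall j, j < m -> f j \notin A & forall j k, j < k < m -> f j != f k].
Proof.
move=> hS; suff: forall k, k <= m -> exists f : nat -> V,
    [/\ forall j, j < k -> f j \in S j,
    forall j, j < k -> f j \notin A & forall i j, i < j < k -> f i != f j].
  by move/(_ m (leqnn m)).
elim=> [_|k IH km]; first by exists (fun=> x0); split=> // j k; rewrite ltn0 andbF.
have [f [f1 f2 f3]] := IH (ltnW km).
have /card_gt0P[x] : 0 < #|S k :\: [set y in A ++ [seq f i | i <- iota 0 k]]|.
  rewrite cardsD subn_gt0; apply: leq_trans (hS k km).
  apply: leq_ltn_trans (subset_leq_card (subsetIr _ _)) _.
  rewrite cardsE; apply: leq_ltn_trans (card_size _) _.
  by rewrite size_cat size_map size_iota addnC ltn_add2r.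
rewrite !inE mem_cat negb_or => /andP[/andP[xA xf] xS].
exists (fun i => if i == k then x else f i); split=> [j|j|i j].
- by rewrite ltnS leq_eqVlt; case: eqP => [->|_] //=; exact: f1.
- by rewrite ltnS leq_eqVlt; case: eqP => [->|_] //=; exact: f2.
- move=> /andP[ij jk] /=; have -> : (i == k) = false by lia.

  case: (j =P k) => [ejk|njk]; last by apply: f3; lia.
  apply: contra xf => /eqP <-; apply: map_f; rewrite mem_iota; lia.
Qed.

(** * 2-paths with heavy ends *)

Section Heavy.
Variables (V : finType) (e : rel V).
Hypotheses (e_sym : symmetric e) (e_irr : irreflexive e).

Definition nb x := [set y | e x y].
Definition heavy t x y := t <= #|nb x :&: nb y|.
Definition heavy_paths t x :=
  [set p : V * V | [&& e x p.1, e p.1 p.2, p.2 != x & heavy t x p.2]].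

Lemma sum_card_rel (U W : finType) (A : {set U}) (B : {set W}) (R : U -> W -> bool) :
  \sum_(a in A) #|[set b in B | R a b]| = \sum_(b in B) #|[set a in A | R a b]|.
Proof.
under eq_bigr do rewrite -sum1_card.
under [RHS]eq_bigr do rewrite -sum1_card.
rewrite (exchange_big_dep (mem B)) /=; last by move=> i j _; rewrite inE => /andP[].
by apply: eq_bigr => b bB; apply: eq_bigl => a; rewrite !inE bB.
Qed.

Lemma exists_in_le (U : finType) (A : {set U}) (f g : U -> nat) :
  \sum_(a in A) f a <= \sum_(a in A) g a -> A != set0 ->
  exists2 a, a \in A & f a <= g a.
Proof.
move=> le_fg /set0Pn[a0 a0A].
have [|/existsPn h] := boolP [exists a in A, f a <= g a].
  by case/existsP=> a /andP[]; exists a.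
suff: \sum_(a in A) g a < \sum_(a in A) f a by rewrite ltnNge le_fg.
rewrite (bigD1 a0) //= [ltnRHS](bigD1 a0) //= -addSn.
have lt a : a \in A -> g a < f a by move=> aA; have := h a; rewrite aA /= -ltnNge.
by apply: leq_add; [exact: lt | apply: leq_sum => a /andP[/lt/ltnW]].
Qed.

(* Many heavy 2-paths from x force a large average codegree inside N(x), so for some w most
   pairs in N(x) :&: N(w) have large codegree. Then r_1 = x, r_3 = w, the vertices r_2, r_4, v_3
   are taken in N(x) :&: N(w), and v_2, v_4, v_1 are common neighbours chosen greedily. *)
Lemma heavy_paths_few l M t x :
  8 * (4 * l + 4) * M + 4 * l + 8 <= t ->
  ~ blowup_in e l -> M * #|heavy_paths t x| <= #|nb x| ^ 2.
Proof.
(* [s] is the number of vertices of T^l, so [s] candidates for each vertex are enough for the greedy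
   embedding. *)
set s := 4 * l + 4 => ht nbl; rewrite leqNgt; apply/negP => hE; apply: nbl.
pose Z := nb x; pose P w := Z :&: nb w.
pose W := [set w | (w != x) && (t <= #|P w|)].
(* Only common neighbours in [W] count: a [v2 j] taken from [W] has at least [t] common neighbours
   with x, among which [v1 j] is found at the end. *)
pose cd z z' := #|[set w in W | (z \in P w) && (z' \in P w)]|.
have EE : #|heavy_paths t x| = \sum_(w in W) #|P w|.
  have -> : \sum_(w in W) #|P w| = \sum_(w in W) #|[set z in Z | e w z]|.
    by apply: eq_bigr => w _; apply: eq_card => z; rewrite !inE.
  have inj : injective (fun p : V * V => (p.2, p.1)) by move=> [a b] [c d] [-> ->].
  rewrite -(card_imset _ inj).
  under eq_bigr do rewrite -sum1_card.
  rewrite pair_big_dep /= -sum1_card; apply: eq_bigl => -[w z] /=.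
  rewrite !inE; apply/imsetP/idP => [[[z' w']]|h].
    rewrite !inE /= => /and4P[h1 h2 h3 h4] [-> ->].
    by move: h4; rewrite h1 h3 e_sym h2 /heavy /= andbT.
  exists (z, w) => //; rewrite !inE /=.
  by case/andP: h => /andP[-> h4] /andP[-> h2]; rewrite e_sym h2 /=.
pose light w := [set p in [set: V * V] | [&& p.1 \in P w, p.2 \in P w & cd p.1 p.2 < s]].
(* A pair with [cd] below [s] is light for fewer than [s] vertices w. *)
have lightS : \sum_(w in W) #|light w| <= s * #|Z| ^ 2.
  rewrite (sum_card_rel W [set: V * V] (fun w p => [&& p.1 \in P w, p.2 \in P w & cd p.1 p.2 < s])).
  apply: (@leq_trans (\sum_(p in setX Z Z) s)); last first.
    by rewrite sum_nat_const cardsX mulnC expnS expn1.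
  rewrite [leqLHS](bigID (mem (setX Z Z))) /=.
  rewrite [X in _ + X]big1 ?addn0.
    rewrite (eq_bigl (mem (setX Z Z))) => [|p]; last by rewrite inE.
    apply: leq_sum => -[z z'] _ /=.
    have [lt|ge] := ltnP (cd z z') s.
      apply: leq_trans (ltnW lt); apply: subset_leq_card.
      by apply/subsetP=> w; rewrite !inE andbT.
    by rewrite eq_card0 // => w; rewrite !inE !andbF.
  move=> [z z']; rewrite inE /= in_setX => h; apply: eq_card0 => w.
  rewrite !inE in h *; apply/negP => /and3P[_ /andP[a _] /andP[/andP[b _] _]].
  by rewrite a b in h.
have Wn0 : W != set0.
  apply/eqP => W0; move: hE; rewrite EE W0 big_set0 muln0; lia.
have [w wW hw] : exists2 w, w \in W & 8 * #|light w| <= #|P w| ^ 2.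
  apply: exists_in_le Wn0; rewrite -big_distrr /=.
  apply: (@leq_trans (8 * (s * #|Z| ^ 2))); first by rewrite leq_mul2l lightS orbT.
  apply: (@leq_trans (8 * s * (M * #|heavy_paths t x|))).
    by rewrite mulnA leq_mul2l ltnW ?orbT.
  rewrite EE mulnA; apply: (@leq_trans (t * \sum_(w in W) #|P w|)).
    by rewrite leq_mul2r; apply/orP; right; lia.
  rewrite big_distrr /=; apply: leq_sum => w; rewrite inE => /andP[_ h].
  by rewrite expnS expn1 leq_mul2r h orbT.
have [wx dt] : w != x /\ t <= #|P w| by move: wW; rewrite inE => /andP[].
set d := #|P w| in dt hw.
pose L z := [set z' in P w | cd z z' < s].
have sumL : \sum_(z in P w) #|L z| = #|light w|.
  under eq_bigr do rewrite -sum1_card.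
  rewrite pair_big_dep /= -sum1_card; apply: eq_bigl => -[a b] /=.
  by rewrite !inE /=.
pose bad := [set z in P w | d < 4 * #|L z|].
have badd : 2 * #|bad| <= d.
  have h1 : #|bad| * d <= 4 * #|light w|.
    rewrite -sumL big_distrr /= -sum_nat_const.
    rewrite [leqRHS](bigID (fun z => d < 4 * #|L z|)) /=.
    apply: leq_trans (leq_addr _ _).
    rewrite [leqLHS](eq_bigl (fun z => (z \in P w) && (d < 4 * #|L z|))) => [|z]; last by rewrite inE.
    by apply: leq_sum => z /andP[_ /ltnW].
  have d0 : 0 < d by lia.
  rewrite -(leq_pmul2r d0); move: h1 hw; rewrite expnS expn1; lia.
have /card_gt1P[r2 [r4 [h2 h4 r24]]] : 1 < #|P w :\: bad|.
  rewrite cardsD; have : #|P w :&: bad| <= #|bad| by apply/subset_leq_card/subsetIr.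
  rewrite -/d; lia.
have lab z : z \in P w :\: bad -> z \in P w /\ 4 * #|L z| <= d.
  rewrite !inE => /andP[h3 /andP[a b]]; rewrite a b /= in h3 *; split=> //.
  by rewrite leqNgt.
have [r2P r2L] := lab _ h2; have [r4P r4L] := lab _ h4.
(* Neither root is bad, so [L r2] and [L r4] together cover at most half of [P w]; as
   [d >= 4 * l + 8], at least [l + 2] candidates remain. *)
have [|v3 [v3S v3A v3i]] :=
    @sdr_avoid V x l (fun=> P w :\: (L r2 :|: L r4)) [:: r2; r4].
  move=> j jl; rewrite cardsD /= -/d.
  have := subset_leq_card (subsetIr (P w) (L r2 :|: L r4)).
  have := (leq_card_setU (L r2) (L r4)).1; lia.
have v3P j : j < l -> [/\ v3 j \in P w, s <= cd r2 (v3 j) & s <= cd r4 (v3 j)].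
  move=> jl; have := v3S j jl; rewrite !inE => /andP[h3 /andP[a b]]; rewrite a b /= in h3 *.
  by move: h3; rewrite negb_or -!leqNgt => /andP[].
pose A3 := [:: x; w; r2; r4] ++ [seq v3 i | i <- iota 0 l].
have [|v2 [v2S v2A v2i]] := @sdr_avoid V x l
    (fun j => [set w in W | (r2 \in P w) && (v3 j \in P w)]) A3.
  move=> j jl; rewrite size_cat size_map size_iota /=.
  have [_ h _] := v3P j jl; apply: leq_trans h; lia.
pose A2 := A3 ++ [seq v2 i | i <- iota 0 l].
have [|v4 [v4S v4A v4i]] := @sdr_avoid V x l
    (fun j => [set w in W | (r4 \in P w) && (v3 j \in P w)]) A2.
  move=> j jl; rewrite !size_cat !size_map !size_iota /=.
  have [_ _ h] := v3P j jl; apply: leq_trans h; lia.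
pose A4 := A2 ++ [seq v4 i | i <- iota 0 l].
have [|v1 [v1S v1A v1i]] := @sdr_avoid V x l (fun j => P (v2 j)) A4.
  move=> j jl; rewrite !size_cat !size_map !size_iota /=.
  have := v2S j jl; rewrite inE => /andP[h _]; move: h; rewrite inE => /andP[_ h].
  apply: leq_trans h; lia.
have eP z y : z \in P y -> [/\ e x z, e z x, e z y & e y z].
  by rewrite !inE => /andP[a b]; rewrite a b e_sym a e_sym b.
have ne a b : e a b -> (a == b) = false by apply: contraTF => /eqP ->; rewrite e_irr.
have [xr2 r2x r2w wr2] := eP _ _ r2P; have [xr4 r4x r4w wr4] := eP _ _ r4P.
have mI (f : nat -> V) k : k < l -> f k \in [seq f i | i <- iota 0 l].
  by move=> kl; apply: map_f; rewrite mem_iota.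
have inA3 k : k < l -> v3 k \in A3 by move=> kl; rewrite mem_cat mI ?orbT.
have A32 a : a \in A3 -> a \in A2 by move=> h; rewrite mem_cat h.
have A24 a : a \in A2 -> a \in A4 by move=> h; rewrite mem_cat h.
have inA2 k : k < l -> v2 k \in A2 by move=> kl; rewrite mem_cat mI ?orbT.
have inA4 k : k < l -> v4 k \in A4 by move=> kl; rewrite mem_cat mI ?orbT.
have nA (f : nat -> V) (A : seq V) : (forall j, j < l -> f j \notin A) ->
    forall a j, j < l -> a \in A -> (f j == a) = false.
  by move=> h a j jl aA; apply: contraNF (h j jl) => /eqP ->.
have rA a : a \in [:: x; w; r2; r4] -> a \in A3 by move=> h; rewrite mem_cat h.
have e23 j k : j < l -> k < l -> (v2 j == v3 k) = false.
  by move=> jl kl; apply: (nA _ _ v2A) => //; exact: inA3.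
have e43 j k : j < l -> k < l -> (v4 j == v3 k) = false.
  by move=> jl kl; apply: (nA _ _ v4A) => //; exact/A32/inA3.
have e42 j k : j < l -> k < l -> (v4 j == v2 k) = false.
  by move=> jl kl; apply: (nA _ _ v4A) => //; exact/inA2.
have e13 j k : j < l -> k < l -> (v1 j == v3 k) = false.
  by move=> jl kl; apply: (nA _ _ v1A) => //; exact/A24/A32/inA3.
have e12 j k : j < l -> k < l -> (v1 j == v2 k) = false.
  by move=> jl kl; apply: (nA _ _ v1A) => //; exact/A24/inA2.
have e14 j k : j < l -> k < l -> (v1 j == v4 k) = false.
  by move=> jl kl; apply: (nA _ _ v1A) => //; exact/inA4.
exists [:: x; r2; w; r4], (fun j => [:: v1 j; v2 j; v3 j; v4 j]); split=> //.
- by rewrite /= !inE (ne _ _ xr2) (ne _ _ xr4) (ne _ _ r2w) (ne _ _ wr4) eq_sym (negPf wx) r24.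
- move=> j jl.
  have [v3w _ _] := v3P j jl; have [xv3 v3x v3w' wv3] := eP _ _ v3w.
  have [xv1 v1x v12 v21] := eP _ _ (v1S j jl).
  have := v2S j jl; rewrite inE => /andP[_ /andP[/eP[_ _ r2v2 v2r2] /eP[_ _ v32 v23]]].
  have := v4S j jl; rewrite inE => /andP[_ /andP[/eP[_ _ r4v4 v4r4] /eP[_ _ v34 v43]]].
  split.
  + by rewrite /= !inE !(eq_sym (v2 _) (v4 _)) !(eq_sym (v3 _) (v4 _)) e12 // e13 // e14 // e23 // e42 // e43.
  + by rewrite /= xv1 r2v2 wv3 r4v4.
  + by rewrite /= v12 v23 v34.
  + have v3r : v3 j \notin [:: x; r2; w; r4].
      have := v3A j jl; rewrite !inE (ne _ _ v3x) (ne _ _ v3w') /=.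
      by rewrite !negb_or.
    have H f : (forall a, a \in A3 -> (f j == a) = false) -> f j \notin [:: x; r2; w; r4].
      move=> h; rewrite !inE !h //; apply: rA; by rewrite !inE eqxx ?orbT.
    apply/hasPn => a; rewrite in_cons in_cons in_cons inE => /or4P[] /eqP ->;
      [ | | exact: v3r | ]; apply: H => b bA.
    * by apply: (nA _ _ v1A) => //; exact/A24/A32.
    * exact: (nA _ _ v2A).
    * by apply: (nA _ _ v4A) => //; exact/A32.
- move=> j k /andP[jk kl]; have jl := ltn_trans jk kl.
  have f1 : (v1 k == v1 j) = false by apply/negbTE; rewrite eq_sym v1i ?jk.
  have f2 : (v2 k == v2 j) = false by apply/negbTE; rewrite eq_sym v2i ?jk.
  have f3 : (v3 k == v3 j) = false by apply/negbTE; rewrite eq_sym v3i ?jk.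
  have f4 : (v4 k == v4 j) = false by apply/negbTE; rewrite eq_sym v4i ?jk.
  rewrite /= !inE f1 f2 f3 f4 e12 // e13 // e14 // e23 // e42 // e43 //=.
  rewrite (eq_sym (v2 k) (v1 j)) e12 // (eq_sym (v2 k) (v4 j)) e42 //.
  rewrite (eq_sym (v3 k) (v1 j)) e13 // (eq_sym (v3 k) (v2 j)) e23 //.
  rewrite (eq_sym (v3 k) (v4 j)) e43 // (eq_sym (v4 k) (v1 j)) e14 //.
Qed.
End Heavy.

Lemma greedy_independent (U : finType) (u0 : U) (Q : {set U}) (R : rel U) l m :
  (forall q, q \in Q -> #|[set q' in Q | R q q']| <= m) -> l * m < #|Q| ->
  exists f : nat -> U, (forall j, j < l -> f j \in Q) /\
    forall j k, j < k < l -> ~~ R (f j) (f k).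
Proof.
move=> hR hQ; suff: forall i, i <= l -> exists f : nat -> U,
    (forall j, j < i -> f j \in Q) /\ forall j k, j < k < i -> ~~ R (f j) (f k).
  by move/(_ l (leqnn l)).
elim=> [_|i IH il]; first by exists (fun=> u0); split=> // j k; rewrite ltn0 andbF.
have [f [f1 f2]] := IH (ltnW il).
have /card_gt0P[x] : 0 < #|Q :\: \bigcup_(j < i) [set q' in Q | R (f j) q']|.
  rewrite cardsD subn_gt0; apply: leq_ltn_trans hQ.
  apply: leq_trans (subset_leq_card (subsetIr _ _)) _.
  apply: leq_trans (_ : \sum_(j < i) #|[set q' in Q | R (f j) q']| <= _).
    elim/big_rec2: _ => [|j A B _ h]; first by rewrite cards0.
    by apply: leq_trans (leq_card_setU _ _).1 _; rewrite leq_add2l.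
  apply: leq_trans (_ : i * m <= _); last by rewrite leq_mul2r (ltnW il) orbT.
  rewrite -[i in leqRHS]card_ord -sum_nat_const; apply: leq_sum => j _.
  by apply: hR; apply: f1.
rewrite inE => /andP[xn xQ].
exists (fun j => if j == i then x else f j); split=> [j|j k].
  by rewrite ltnS leq_eqVlt; case: (j =P i) => [->|_] //=; exact: f1.
move=> /andP[jk ki] /=; have -> : (j == i) = false by lia.
case: (k =P i) => [eki|nki]; last by apply: f2; lia.
have ji : j < i by lia.
apply: contra xn => h; apply/bigcupP; exists (Ordinal ji) => //.
by rewrite inE xQ.
Qed.

Lemma card_fiber_le (U W : finType) (X : {set U}) (Y : {set W}) (g : U -> W) m :
  (forall x, x \in X -> g x \in Y) ->
  (forall y, y \in Y -> #|[set x in X | g x == y]| <= m) -> #|X| <= #|Y| * m.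
Proof.
move=> gY hm; rewrite -sum_nat_const -sum1_card.
rewrite (partition_big g (mem Y)) //=; apply: leq_sum => y yY.
by apply: leq_trans (hm y yY); rewrite sum1dep_card; apply: subset_leq_card;
  apply/subsetP => x; rewrite !inE.
Qed.

Lemma card_quad (V : finType) (S1 : {set V}) (S2 : V -> {set V})
    (S3 : V -> V -> {set V}) (S4 : V -> V -> V -> {set V}) :
  #|[set p : V * V * V * V | let: (a, b, c, d) := p in
      [&& a \in S1, b \in S2 a, c \in S3 a b & d \in S4 a b c]]| =
  \sum_(a in S1) \sum_(b in S2 a) \sum_(c in S3 a b) #|S4 a b c|.
Proof.
rewrite pair_big_dep /= pair_big_dep /=.
under [RHS]eq_bigr do rewrite -sum1_card.
rewrite pair_big_dep /= -sum1_card; apply: eq_bigl => -[[[a b] c] d] /=.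
by rewrite inE !andbA.
Qed.

Lemma card_quad_ge (V : finType) (S1 : {set V}) (S2 : V -> {set V})
    (S3 : V -> V -> {set V}) (S4 : V -> V -> V -> {set V}) m1 m2 m3 m4 :
  m1 <= #|S1| -> (forall a, a \in S1 -> m2 <= #|S2 a|) ->
  (forall a b, a \in S1 -> b \in S2 a -> m3 <= #|S3 a b|) ->
  (forall a b c, a \in S1 -> b \in S2 a -> c \in S3 a b -> m4 <= #|S4 a b c|) ->
  m1 * (m2 * (m3 * m4)) <= #|[set p : V * V * V * V | let: (a, b, c, d) := p in
      [&& a \in S1, b \in S2 a, c \in S3 a b & d \in S4 a b c]]|.
Proof.
move=> h1 h2 h3 h4; rewrite card_quad.
have step (S : {set V}) m k (F : V -> nat) : m <= #|S| ->
    (forall a, a \in S -> k <= F a) -> m * k <= \sum_(a in S) F a.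
  move=> hm hk; apply: leq_trans (_ : #|S| * k <= _); first by rewrite leq_mul2r hm orbT.
  by rewrite -sum_nat_const; apply: leq_sum.
apply: (step _ _ _ _ h1) => a aS; apply: (step _ _ _ _ (h2 a aS)) => b bS.
by apply: (step _ _ _ _ (h3 a b aS bS)) => c cS; exact: h4.
Qed.

(** * Light copies on one root tuple *)

Section Light.
Variables (V : finType) (e : rel V).
Hypotheses (e_sym : symmetric e) (e_irr : irreflexive e).
Let nb := nb e.
Let heavy := heavy e.

(** The six pairs are the ends of the 2-paths r_i, v_i, v_(i+1) and r_i, v_i, v_(i-1). Since they
    are not heavy, r_i and a path neighbour of v_i leave fewer than [t] choices for v_i. *)
Definition light_copy t (r p : V * V * V * V) :=
  let: (r1, r2, r3, r4) := r in let: (a, b, c, d) := p in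
  [&& uniq [:: a; b; c; d; r1; r2; r3; r4], all2 e [:: r1; r2; r3; r4] [:: a; b; c; d],
      sorted e [:: a; b; c; d] & [&& ~~ heavy t b r1, ~~ heavy t a r2, ~~ heavy t c r2,
      ~~ heavy t b r3, ~~ heavy t d r3 & ~~ heavy t c r4]].

Definition quadseq (p : V * V * V * V) := let: (a, b, c, d) := p in [:: a; b; c; d].

(** A copy meeting a given one has one of the 4 given vertices at one of its 4 positions, and each
    case leaves at most [t ^ 3] copies; this is the 16. *)
Lemma light_copies_blowup l t r (Q : {set V * V * V * V}) :
  (forall p, p \in Q -> light_copy t r p) -> l * (16 * t ^ 3) < #|Q| -> blowup_in e l.
Proof.
case: r => [[[r1 r2] r3] r4] hQ cQ.
have fib w : [/\ #|[set p in Q | p.1.1.1 == w]| <= t ^ 3,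
    #|[set p in Q | p.1.1.2 == w]| <= t ^ 3, #|[set p in Q | p.1.2 == w]| <= t ^ 3 &
    #|[set p in Q | p.2 == w]| <= t ^ 3].
  have t3 : t ^ 3 = t * (t * (t * 1)) by rewrite muln1 !expnS expn0 muln1.
  (* [cnt] peels off one coordinate, a common neighbour of a known path vertex and a root. That this
     pair is not heavy is read off a member of [X], hence the premise [X != set0]. *)
  have cnt (X : {set V * V * V * V}) (g : V * V * V * V -> V) y r0 m :
      (forall p, p \in X -> e y (g p) && e r0 (g p)) ->
      (X != set0 -> ~~ heavy t y r0) ->
      (forall z, #|[set p in X | g p == z]| <= m) -> #|X| <= t * m.
    move=> h1 h2 h3; have [->|X0] := eqVneq X set0; first by rewrite cards0.
    apply: leq_trans (_ : #|nb y :&: nb r0| * m <= _).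
      by apply: card_fiber_le => [p pX|z _ //]; rewrite !inE; exact: h1.
    by rewrite leq_mul2r -ltnS ltnW ?orbT // ltnS ltnNge; exact: h2.
  have one (X : {set V * V * V * V}) p0 : (forall p, p \in X -> p = p0) -> #|X| <= 1.
    move=> h; rewrite -(cards1 p0); apply: subset_leq_card.
    by apply/subsetP => p /h ->; rewrite inE.
  split; rewrite t3.
  - apply: (@cnt _ (fun p => p.1.1.2) w r2) => [p|/set0Pn[p]|w2].
    + by rewrite inE => /andP[/hQ]; case: p => [[[a b] c] d] /= /and4P[_ /and5P[_ ? _ _ _] /and4P[? _ _ _] _] /eqP <-; apply/andP.
    + by rewrite inE => /andP[/hQ]; case: p => [[[a b] c] d] /= /and4P[_ _ _ /and5P[_ ? _ _ _]] /eqP <-.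
    apply: (@cnt _ (fun p => p.1.2) w2 r3) => [p|/set0Pn[p]|w3].
    + by rewrite !inE => /andP[/andP[/hQ]]; case: p => [[[a b] c] d] /= /and4P[_ /and5P[_ _ ? _ _] /and4P[_ ? _ _] _] _ /eqP <-; apply/andP.
    + by rewrite !inE => /andP[/andP[/hQ]]; case: p => [[[a b] c] d] /= /and4P[_ _ _ /and5P[_ _ _ ? _]] _ /eqP <-.
    apply: (@cnt _ (fun p => p.2) w3 r4) => [p|/set0Pn[p]|w4].
    + by rewrite !inE => /andP[/andP[/andP[/hQ]]]; case: p => [[[a b] c] d] /= /and4P[_ /and5P[_ _ _ ? _] /and4P[_ _ ? _] _] _ _ /eqP <-; apply/andP.
    + by rewrite !inE => /andP[/andP[/andP[/hQ]]]; case: p => [[[a b] c] d] /= /and4P[_ _ _ /and5P[_ _ _ _ /andP[_ ?]]] _ _ /eqP <-.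
    apply: (one _ (w, w2, w3, w4)) => -[[[a b] c] d]; rewrite !inE /=.
    by move=> /andP[/andP[/andP[/andP[_ /eqP->] /eqP->] /eqP->] /eqP->].
  - apply: (@cnt _ (fun p => p.1.1.1) w r1) => [p|/set0Pn[p]|w2].
    + by rewrite inE => /andP[/hQ]; case: p => [[[a b] c] d] /= /and4P[_ /and5P[? _ _ _ _] /and4P[? _ _ _] _] /eqP <-; rewrite [e b a]e_sym; apply/andP.
    + by rewrite inE => /andP[/hQ]; case: p => [[[a b] c] d] /= /and4P[_ _ _ /and5P[? _ _ _ _]] /eqP <-.
    apply: (@cnt _ (fun p => p.1.2) w r3) => [p|/set0Pn[p]|w3].
    + by rewrite !inE => /andP[/andP[/hQ]]; case: p => [[[a b] c] d] /= /and4P[_ /and5P[_ _ ? _ _] /and4P[_ ? _ _] _] /eqP <- _; apply/andP.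
    + by rewrite !inE => /andP[/andP[/hQ]]; case: p => [[[a b] c] d] /= /and4P[_ _ _ /and5P[_ _ _ ? _]] /eqP <- _.
    apply: (@cnt _ (fun p => p.2) w3 r4) => [p|/set0Pn[p]|w4].
    + by rewrite !inE => /andP[/andP[/andP[/hQ]]]; case: p => [[[a b] c] d] /= /and4P[_ /and5P[_ _ _ ? _] /and4P[_ _ ? _] _] _ _ /eqP <-; apply/andP.
    + by rewrite !inE => /andP[/andP[/andP[/hQ]]]; case: p => [[[a b] c] d] /= /and4P[_ _ _ /and5P[_ _ _ _ /andP[_ ?]]] _ _ /eqP <-.
    apply: (one _ (w2, w, w3, w4)) => -[[[a b] c] d]; rewrite !inE /=.
    by move=> /andP[/andP[/andP[/andP[_ /eqP->] /eqP->] /eqP->] /eqP->].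
  - apply: (@cnt _ (fun p => p.1.1.2) w r2) => [p|/set0Pn[p]|w2].
    + by rewrite inE => /andP[/hQ]; case: p => [[[a b] c] d] /= /and4P[_ /and5P[_ ? _ _ _] /and4P[_ ? _ _] _] /eqP <-; rewrite [e c b]e_sym; apply/andP.
    + by rewrite inE => /andP[/hQ]; case: p => [[[a b] c] d] /= /and4P[_ _ _ /and5P[_ _ ? _ _]] /eqP <-.
    apply: (@cnt _ (fun p => p.1.1.1) w2 r1) => [p|/set0Pn[p]|w3].
    + by rewrite !inE => /andP[/andP[/hQ]]; case: p => [[[a b] c] d] /= /and4P[_ /and5P[? _ _ _ _] /and4P[? _ _ _] _] _ /eqP <-; rewrite [e b a]e_sym; apply/andP.
    + by rewrite !inE => /andP[/andP[/hQ]]; case: p => [[[a b] c] d] /= /and4P[_ _ _ /and5P[? _ _ _ _]] _ /eqP <-.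
    apply: (@cnt _ (fun p => p.2) w r4) => [p|/set0Pn[p]|w4].
    + by rewrite !inE => /andP[/andP[/andP[/hQ]]]; case: p => [[[a b] c] d] /= /and4P[_ /and5P[_ _ _ ? _] /and4P[_ _ ? _] _] /eqP <- _ _; apply/andP.
    + by rewrite !inE => /andP[/andP[/andP[/hQ]]]; case: p => [[[a b] c] d] /= /and4P[_ _ _ /and5P[_ _ _ _ /andP[_ ?]]] /eqP <- _ _.
    apply: (one _ (w3, w2, w, w4)) => -[[[a b] c] d]; rewrite !inE /=.
    by move=> /andP[/andP[/andP[/andP[_ /eqP->] /eqP->] /eqP->] /eqP->].
  - apply: (@cnt _ (fun p => p.1.2) w r3) => [p|/set0Pn[p]|w3].
    + by rewrite inE => /andP[/hQ]; case: p => [[[a b] c] d] /= /and4P[_ /and5P[_ _ ? _ _] /and4P[_ _ ? _] _] /eqP <-; rewrite [e d c]e_sym; apply/andP.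
    + by rewrite inE => /andP[/hQ]; case: p => [[[a b] c] d] /= /and4P[_ _ _ /and5P[_ _ _ _ /andP[? _]]] /eqP <-.
    apply: (@cnt _ (fun p => p.1.1.2) w3 r2) => [p|/set0Pn[p]|w2].
    + by rewrite !inE => /andP[/andP[/hQ]]; case: p => [[[a b] c] d] /= /and4P[_ /and5P[_ ? _ _ _] /and4P[_ ? _ _] _] _ /eqP <-; rewrite [e c b]e_sym; apply/andP.
    + by rewrite !inE => /andP[/andP[/hQ]]; case: p => [[[a b] c] d] /= /and4P[_ _ _ /and5P[_ _ ? _ _]] _ /eqP <-.
    apply: (@cnt _ (fun p => p.1.1.1) w2 r1) => [p|/set0Pn[p]|w4].
    + by rewrite !inE => /andP[/andP[/andP[/hQ]]]; case: p => [[[a b] c] d] /= /and4P[_ /and5P[? _ _ _ _] /and4P[? _ _ _] _] _ _ /eqP <-; rewrite [e b a]e_sym; apply/andP.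
    + by rewrite !inE => /andP[/andP[/andP[/hQ]]]; case: p => [[[a b] c] d] /= /and4P[_ _ _ /and5P[? _ _ _ _]] _ _ /eqP <-.
    apply: (one _ (w4, w2, w3, w)) => -[[[a b] c] d]; rewrite !inE /=.
    by move=> /andP[/andP[/andP[/andP[_ /eqP->] /eqP->] /eqP->] /eqP->].
have fibm w : #|[set p in Q | w \in quadseq p]| <= 4 * t ^ 3.
  have [f1 f2 f3 f4] := fib w.
  have sub : [set p in Q | w \in quadseq p] \subset
      ([set p in Q | p.1.1.1 == w] :|: [set p in Q | p.1.1.2 == w]) :|:
      ([set p in Q | p.1.2 == w] :|: [set p in Q | p.2 == w]).
    apply/subsetP => -[[[a b] c] d]; rewrite !inE /= => /andP[-> /=].
    by rewrite !(eq_sym w) orbA.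
  apply: leq_trans (subset_leq_card sub) _.
  apply: leq_trans (leq_card_setU _ _).1 _.
  have := (leq_card_setU [set p in Q | p.1.1.1 == w] [set p in Q | p.1.1.2 == w]).1.
  have := (leq_card_setU [set p in Q | p.1.2 == w] [set p in Q | p.2 == w]).1.
  lia.
have [p0 p0Q] : exists p, p \in Q by apply/card_gt0P; apply: leq_ltn_trans cQ.
have [|f [fQ fd]] := @greedy_independent _ p0 Q
  (fun p q => has [in quadseq p] (quadseq q)) l (16 * t ^ 3) _ cQ.
  move=> [[[a b] c] d] _.
  have sub : [set q' in Q | has [in quadseq (a, b, c, d)] (quadseq q')] \subset
      ([set p in Q | a \in quadseq p] :|: [set p in Q | b \in quadseq p]) :|:
      ([set p in Q | c \in quadseq p] :|: [set p in Q | d \in quadseq p]).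
    apply/subsetP => q; rewrite !inE => /andP[-> /hasP[x xq]] /=.
    by rewrite !inE -orbA => /or4P[] /eqP <-; rewrite xq ?orbT.
  apply: leq_trans (subset_leq_card sub) _.
  apply: leq_trans (leq_card_setU _ _).1 _.
  apply: leq_trans (leq_add (leq_card_setU _ _).1 (leq_card_setU _ _).1) _.
  have -> : 16 * t ^ 3 = (4 * t ^ 3 + 4 * t ^ 3) + (4 * t ^ 3 + 4 * t ^ 3) by lia.
  by apply: leq_add; apply: leq_add.
exists [:: r1; r2; r3; r4], (fun j => quadseq (f j)).
have cp : forall p, p \in Q -> [/\ uniq (quadseq p ++ [:: r1; r2; r3; r4]),
   all2 e [:: r1; r2; r3; r4] (quadseq p) & sorted e (quadseq p)].
  by move=> [[[a b] c] d] /hQ /and4P[].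
split=> //.
- by have [] := cp _ p0Q; rewrite cat_uniq => /and3P[].
- move=> j jl; have [u1 ? ?] := cp _ (fQ j jl).
  move: u1; rewrite cat_uniq => /and3P[? h _]; split=> //.
  by rewrite has_sym.
Qed.
End Light.

(** * Almost regular graphs *)

Section Regular.
Variables (V : finType) (e : rel V).
Hypotheses (e_sym : symmetric e) (e_irr : irreflexive e).

Lemma sum_nb_le D (f : V -> nat) : (forall x, #|nb e x| <= D) ->
  \sum_a \sum_(b in nb e a) f b <= D * \sum_b f b.
Proof.
move=> hD; rewrite (exchange_big_dep xpredT) //= big_distrr /=.
apply: leq_sum => b _; rewrite sum_nat_const leq_mul2r; apply/orP; right.
apply: leq_trans (hD b); apply: subset_leq_card; apply/subsetP => a.
move=> h; rewrite inE e_sym; have : b \in nb e a by exact: h.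
by rewrite inE.
Qed.

(** With n = [#|A|], at least [n * dl ^ 3 / 4] good paths have at least [(dl / 3) ^ 4] root tuples
    each, while each of the [n ^ 4] root tuples serves at most [l * (16 * t ^ 3)] paths. Here 324 =
    4 * 81. *)
Lemma regular_blowup_free l K M t (A : {set V}) dl :
  ~ blowup_in e l ->
  192 * K ^ 4 <= M -> 8 * (4 * l + 4) * M + 4 * l + 8 <= t ->
  (forall x, x \in A -> dl <= #|nb e x| <= K * dl) ->
  (forall x y, e x y -> x \in A) -> 0 < #|A| -> 32 <= dl ->
  dl ^ 7 <= 324 * (l * (16 * t ^ 3)) * #|A| ^ 3.
Proof.
move=> nbl hM ht hdeg hA A0 dl32.
have nA x : x \notin A -> nb e x = set0.
  by move=> xA; apply/setP => y; rewrite !inE; apply: contraNF xA => /hA.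
pose D := K * dl.
have hD x : #|nb e x| <= D.
  by have [/hdeg/andP[]//|/nA->] := boolP (x \in A); rewrite cards0.
pose H x z := [set w in nb e z | (w != x) && heavy e t x w].
pose NO x := [set z in nb e x | dl < 8 * #|H x z|].
have hNO x : M * #|NO x| <= 8 * K ^ 2 * dl.
  have h1 : M * #|heavy_paths e t x| <= D ^ 2.
    by apply: leq_trans (heavy_paths_few e_sym e_irr x ht nbl) _; rewrite leq_exp2r.
  have h2 : #|heavy_paths e t x| = \sum_(z in nb e x) #|H x z|.
    under [RHS]eq_bigr do rewrite -sum1_card.
    rewrite pair_big_dep -sum1_card /=; apply: eq_bigl => -[z w] /=.
    by rewrite !inE /=.
  have h3 : #|NO x| * dl <= 8 * #|heavy_paths e t x|.
    rewrite h2 big_distrr /= -sum_nat_const [leqRHS](bigID (fun z => dl < 8 * #|H x z|)) /=.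
    apply: leq_trans (leq_addr _ _).
    rewrite [leqLHS](eq_bigl (fun z => (z \in nb e x) && (dl < 8 * #|H x z|))) => [|z]; last by rewrite inE.
    by apply: leq_sum => z /andP[_ /ltnW].
  have d0 : 0 < dl by lia.
  rewrite -(leq_pmul2r d0) -mulnA.
  apply: leq_trans (_ : M * (8 * #|heavy_paths e t x|) <= _); first by rewrite leq_mul2l h3 orbT.
  rewrite mulnCA; move: h1; rewrite /D expnMn; nia.
(* A step is tested in both directions: on an edge ab of the path, the root at b must avoid [H a b]
   and the root at a must avoid [H b a]. *)
pose B x := [set z in nb e x | (z \in NO x) || (x \in NO z)].
have sB : \sum_x #|B x| <= 2 * \sum_x #|NO x|.
  have h1 x : #|B x| <= #|NO x| + #|[set z in [set: V] | x \in NO z]|.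
    apply: leq_trans (leq_card_setU _ _).1; apply: subset_leq_card; apply/subsetP => z.
    rewrite inE => /andP[_ /orP[] h]; apply/setUP; first by left.
    by right; rewrite inE in_setT.
  apply: leq_trans (leq_sum _ (fun x _ => h1 x)) _.
  rewrite big_split /= mul2n -addnn leq_add2l.
  have := sum_card_rel [set: V] [set: V] (fun x z => x \in NO z).
  rewrite (eq_bigl xpredT) => [->|x]; last by rewrite inE.
  rewrite (eq_bigl xpredT) => [|x]; last by rewrite inE.
  by apply: leq_sum => z _; apply: subset_leq_card; apply/subsetP => x; rewrite !inE.
set n := #|A| in A0 *.
have sB2 : M * \sum_x #|B x| <= 16 * K ^ 2 * dl * n.
  apply: leq_trans (_ : M * (2 * \sum_x #|NO x|) <= _); first by rewrite leq_mul2l sB orbT.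
  rewrite mulnCA big_distrr /= (bigID (mem A)) /= [X in _ + X]big1 ?addn0.
    apply: leq_trans (_ : 2 * \sum_(x in A) 8 * K ^ 2 * dl <= _).
      by rewrite leq_mul2l; apply/orP; right; apply: leq_sum => x _; exact: hNO.
    by rewrite sum_nat_const -/n; lia.
  move=> x /nA h; rewrite [NO x](_ : _ = set0) ?cards0 ?muln0 //.
  by apply/setP => z; rewrite inE h !inE.
pose Q3 (X1 X2 X3 : V -> {set V}) := [set p : V * V * V * V | let: (a, b, c, d) := p in
      [&& a \in [set: V], b \in X1 a, c \in X2 b & d \in X3 c]].
have bw : #|Q3 B (nb e) (nb e)| + (#|Q3 (nb e) B (nb e)| + #|Q3 (nb e) (nb e) B|)
   <= 3 * D ^ 2 * \sum_x #|B x|.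
  have q1 X1 X2 X3 : #|Q3 X1 X2 X3| = \sum_a \sum_(b in X1 a) \sum_(c in X2 b) #|X3 c|.
    rewrite card_quad; by apply: eq_bigl => a; rewrite inE.
  have up (S : {set V}) (f : V -> nat) k : (forall x, f x <= k) ->
      \sum_(x in S) f x <= #|S| * k.
    by move=> h; rewrite -sum_nat_const; apply: leq_sum.
  rewrite !q1; apply: leq_trans (_ : D ^ 2 * \sum_x #|B x| + (D ^ 2 * \sum_x #|B x| + D ^ 2 * \sum_x #|B x|) <= _); last by lia.
  apply: leq_add; last apply: leq_add.
  - rewrite big_distrr /=; apply: leq_sum => a _; rewrite mulnC; apply: (up) => b.
    apply: leq_trans (up _ _ _ hD) _; by rewrite expnS expn1 leq_mul2r hD orbT.
  - apply: leq_trans (sum_nb_le _ hD) _.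
    rewrite expnS expn1 -mulnA leq_mul2l; apply/orP; right.
    by rewrite big_distrr /=; apply: leq_sum => b _; rewrite mulnC; apply: up.
  - apply: leq_trans (sum_nb_le _ hD) _.
    rewrite expnS expn1 -mulnA leq_mul2l; apply/orP; right; exact: sum_nb_le.
(* The bound on [M] serves here: 192 = 4 * 3 * 16, with three positions for a bad step and 16 from
   [sB2]; [K ^ 4] collects the factors of [D ^ 2] and [sB2]. *)
have bw2 : 4 * (#|Q3 B (nb e) (nb e)| + (#|Q3 (nb e) B (nb e)| + #|Q3 (nb e) (nb e) B|))
   <= n * dl ^ 3.
  have [K0|K0] := posnP K.
    by move: bw; rewrite /D K0 mul0n muln0 mul0n leqn0 => /eqP ->.
  have M0 : 0 < M by apply: leq_trans hM; rewrite muln_gt0 expn_gt0 K0.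
  rewrite -(leq_pmul2l M0).
  apply: leq_trans (_ : M * (4 * (3 * D ^ 2 * \sum_x #|B x|)) <= _).
    by rewrite !leq_mul2l bw !orbT.
  apply: leq_trans (_ : 12 * D ^ 2 * (M * \sum_x #|B x|) <= _); first by lia.
  apply: leq_trans (_ : 12 * D ^ 2 * (16 * K ^ 2 * dl * n) <= _).
    by rewrite leq_mul2l sB2 orbT.
  apply: leq_trans (_ : 192 * K ^ 4 * (n * dl ^ 3) <= _); last by rewrite leq_mul2r hM orbT.
  by rewrite /D; apply/eq_leq; lia.
pose PS := [set p : V * V * V * V | let: (a, b, c, d) := p in
   [&& a \in A, b \in nb e a, c \in nb e b :\ a & d \in nb e c :\: [set a; b]]].
have cPS : n * (dl * ((dl - 1) * (dl - 2))) <= #|PS|.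
  have dA x y : e x y -> dl <= #|nb e y| by rewrite e_sym => /hA/hdeg/andP[].
  apply: (card_quad_ge (S2 := nb e) (S3 := fun a b => nb e b :\ a)
     (S4 := fun a b c => nb e c :\: [set a; b])) => // [a /hdeg/andP[] //|a b aA|a b c aA bn].
  - rewrite inE => ab; have := cardsD1 a (nb e b); have := dA _ _ ab; lia.
  - rewrite !inE => /andP[_ bc]; rewrite cardsD.
    have := subset_leq_card (subsetIr (nb e c) [set a; b]).
    have := cards2 a b; have := dA _ _ bc; lia.
pose GS := [set p in PS | let: (a, b, c, d) := p in [&& b \notin B a, c \notin B b & d \notin B c]].
have cGS : n * dl ^ 3 <= 4 * #|GS|.
  have sub : PS \subset GS :|: (Q3 B (nb e) (nb e) :|: (Q3 (nb e) B (nb e) :|: Q3 (nb e) (nb e) B)).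
    apply/subsetP => -[[[a b] c] d] hp; have := hp.
    rewrite inE => /and4P[_ hab /setDP[hbc _] /setDP[hcd _]].
    have [hb|hb] := boolP (b \in B a).
      by apply/setUP; right; apply/setUP; left; rewrite inE in_setT hb hbc hcd.
    have [hc|hc] := boolP (c \in B b).
      by do 2!(apply/setUP; right); apply/setUP; left; rewrite inE in_setT hab hc hcd.
    have [hd|hd] := boolP (d \in B c).
      by do 3!(apply/setUP; right); rewrite inE in_setT hab hbc hd.
    by apply/setUP; left; rewrite inE hp hb hc hd.
  have := subset_leq_card sub.
  have := (leq_card_setU GS (Q3 B (nb e) (nb e) :|: (Q3 (nb e) B (nb e) :|: Q3 (nb e) (nb e) B))).1.
  have := (leq_card_setU (Q3 B (nb e) (nb e)) (Q3 (nb e) B (nb e) :|: Q3 (nb e) (nb e) B)).1.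
  have := (leq_card_setU (Q3 (nb e) B (nb e)) (Q3 (nb e) (nb e) B)).1.
  have : n * dl ^ 3 <= 2 * (n * (dl * ((dl - 1) * (dl - 2)))).
    rewrite mulnCA leq_mul2l; apply/orP; right; nia.
  lia.
pose m := dl./2.
have m3 : dl <= 3 * m by rewrite /m; lia.
have cR p : p \in GS -> m * (m * (m * m)) <= #|[set r | light_copy e t r p]|.
  case: p => [[[a b] c] d].
  rewrite inE => /andP[]; rewrite inE => /and4P[aA ab' /setD1P[ca bc] /setDP[cd dab]].
  rewrite inE in ab'; rewrite inE in bc; rewrite inE in cd.
  have [da db] : d != a /\ d != b by move: dab; rewrite !inE negb_or => /andP[].
  have nokP x z : e x z -> z \notin B x -> 8 * #|H x z| <= dl /\ 8 * #|H z x| <= dl.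
    move=> xz; rewrite !inE xz [e z x]e_sym xz /= negb_or -!leqNgt.
    by case/andP.
  case/and3P => /(nokP _ _ ab')[hab hba] /(nokP _ _ bc)[hbc hcb] /(nokP _ _ cd)[hcd hdc].
  have dA x y : e x y -> dl <= #|nb e y| by rewrite e_sym => /hA/hdeg/andP[].
  have dA' x y : e x y -> dl <= #|nb e x| by move=> /hA/hdeg/andP[].
  pose qs := [set a; b; c; d].
  have cqs : #|qs| <= 4.
    have := (leq_card_setU ([set a; b; c]) [set d]).1.
    have := (leq_card_setU ([set a; b]) [set c]).1.
    have := (leq_card_setU ([set a]) [set b]).1; rewrite !cards1 /qs; lia.
  (* The root at z avoids two sets of size at most [dl / 8], four path vertices and at most three
     earlier roots: [3 * dl / 4 - 7 >= dl / 2] as [32 <= dl]. *)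
  have szR z (X Y : {set V}) (s : seq V) : dl <= #|nb e z| -> 8 * #|X| <= dl -> 8 * #|Y| <= dl ->
      size s <= 3 -> m <= #|nb e z :\: (X :|: Y :|: (qs :|: [set x in s]))|.
    move=> h1 h2 h3 h4; rewrite cardsD.
    have := subset_leq_card (subsetIr (nb e z) (X :|: Y :|: (qs :|: [set x in s]))).
    have := (leq_card_setU (X :|: Y) (qs :|: [set x in s])).1.
    have := (leq_card_setU X Y).1; have := (leq_card_setU qs [set x in s]).1.
    have : #|[set x in s]| <= 3 by rewrite cardsE; apply: leq_trans (card_size s) h4.
    rewrite /m; lia.
  have h0 : 8 * #|@set0 V| <= dl by rewrite cards0.
  pose S1 := nb e a :\: (H b a :|: set0 :|: (qs :|: [set x in [::]])).
  pose S2 r1 := nb e b :\: (H a b :|: H c b :|: (qs :|: [set x in [:: r1]])).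
  pose S3 r1 r2 := nb e c :\: (H b c :|: H d c :|: (qs :|: [set x in [:: r1; r2]])).
  pose S4 r1 r2 r3 := nb e d :\: (H c d :|: set0 :|: (qs :|: [set x in [:: r1; r2; r3]])).
  apply: leq_trans (card_quad_ge (S1 := S1) (S2 := S2) (S3 := S3) (S4 := S4)
    (m1 := m) (m2 := m) (m3 := m) (m4 := m) _ _ _ _) _.
  - by apply: szR => //; exact: dA' ab'.
  - by move=> *; apply: szR => //; exact: dA ab'.
  - by move=> *; apply: szR => //; exact: dA' cd.
  - by move=> *; apply: szR => //; exact: dA cd.
  apply: subset_leq_card; apply/subsetP => -[[[r1 r2] r3] r4].
  rewrite inE => /and4P[].
  have mS z (X Y : {set V}) s r : r \in nb e z :\: (X :|: Y :|: (qs :|: [set x in s])) ->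
    [/\ e z r, r \notin X, r \notin Y, r \notin [:: a; b; c; d] & r \notin s].
    case/setDP; rewrite inE => zr; rewrite in_setU [r \in X :|: Y]in_setU [r \in qs :|: _]in_setU.
    rewrite !negb_or => /andP[/andP[rX rY] /andP[hq hs]]; rewrite inE in hs; split=> //.
    by move: hq; rewrite /qs !inE !negb_or -!andbA andbT.
  move=> /mS[ar1 n1 _ q1 _] /mS[br2 n2 n2' q2 s2] /mS[cr3 n3 n3' q3 s3] /mS[dr4 n4 _ q4 s4].
  have nH x z w : e z w -> w != x -> w \notin H x z -> ~~ heavy e t x w.
    by move=> h1 h2; rewrite !inE h1 h2.
  have ne x y : e x y -> x != y by apply: contraTneq => ->; rewrite e_irr.
  rewrite inE /light_copy; apply/and4P; split.
  - rewrite -[[:: a, _, _ , _ & _]]/([:: a; b; c; d] ++ [:: r1; r2; r3; r4]) cat_uniq.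
    apply/and3P; split.
    + by rewrite /= !inE !negb_or (ne _ _ ab') (eq_sym a) ca (eq_sym a) da (ne _ _ bc) (eq_sym b) db (ne _ _ cd).
    + apply/hasPn => x; rewrite in_cons in_cons in_cons inE => /or4P[] /eqP -> //.
    + move: s2 s3 s4; rewrite /= !inE !negb_or => h2 /andP[h3 h3'] /and3P[h4 h4' h4''].
      by rewrite (eq_sym r1) h2 (eq_sym r1) h3 (eq_sym r1) h4 (eq_sym r2) h3' (eq_sym r2) h4' (eq_sym r3) h4''.
  - by rewrite /= !(e_sym r1, e_sym r2, e_sym r3, e_sym r4) ar1 br2 cr3 dr4.
  - by rewrite /= ab' bc cd.
  - move: q1 q2 q3 q4; rewrite !inE !negb_or => /and4P[_ ? _ _] /and4P[? _ ? _] /and4P[_ ? _ ?] /and4P[_ _ ? _].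
    apply/and5P; split; [exact: nH n1|exact: nH n2|exact: nH n2'|exact: nH n3|].
    by rewrite (nH _ _ _ _ _ n3') // (nH _ _ _ _ _ n4).
pose A4 := setX (setX (setX A A) A) A.
pose L := l * (16 * t ^ 3).
have cQ r : #|[set p in GS | light_copy e t r p]| <= L.
  rewrite leqNgt; apply/negP => h; apply: nbl.
  by apply: (light_copies_blowup e_sym (r := r) _ h) => p; rewrite inE => /andP[].
have key : #|GS| * (m * (m * (m * m))) <= n ^ 4 * L.
  have -> : n ^ 4 = #|A4| by rewrite !cardsX -/n; lia.
  rewrite -!sum_nat_const.
  apply: leq_trans (_ : \sum_(r in A4) #|[set p in GS | light_copy e t r p]| <= _); last first.
    by apply: leq_sum.
  rewrite (sum_card_rel A4 GS (fun r p => light_copy e t r p)).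
  apply: leq_sum => p pG; apply: leq_trans (cR p pG) _.
  apply: subset_leq_card; apply/subsetP => -[[[r1 r2] r3] r4]; rewrite !inE => h; rewrite h andbT.
  move: h; case: p {pG} => [[[a b] c] d] /= /and4P[_ /and5P[h1 h2 h3 h4 _] _ _].
  by rewrite (hA _ _ h1) (hA _ _ h2) (hA _ _ h3) (hA _ _ h4).
have dl4 : dl ^ 4 <= 81 * (m * (m * (m * m))).
  apply: leq_trans (_ : (3 * m) ^ 4 <= _); first by rewrite leq_exp2r.
  by apply/eq_leq; lia.
rewrite -(leq_pmul2l A0) -/L.
apply: leq_trans (_ : (n * dl ^ 3) * dl ^ 4 <= _); first by apply/eq_leq; lia.
apply: leq_trans (leq_mul cGS dl4) _.
apply: leq_trans (_ : 324 * (#|GS| * (m * (m * (m * m)))) <= _); first by apply/eq_leq; lia.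
apply: leq_trans (_ : 324 * (n ^ 4 * L) <= _); first by rewrite leq_mul2l key.
by apply/eq_leq; lia.
Qed.
End Regular.

(** Removing an element of minimum weight does not lower the average weight; this is repeated until
    [b] elements remain. *)
Lemma heaviest_subset (V : finType) (f : V -> nat) (S : {set V}) b : b <= #|S| ->
  exists T : {set V}, [/\ T \subset S, #|T| = b &
    b * \sum_(x in S) f x <= #|S| * \sum_(x in T) f x].
Proof.
move En: (#|S| - b) => n; elim: n S En => [|n IH] S En hb.
  by exists S; split=> //; [lia | rewrite leq_mul2r hb orbT].
have /card_gt0P[x0 x0S] : 0 < #|S| by lia.
case: (arg_minnP f x0S) => x xS0 xmin; have xS : x \in S := xS0.
have cS := cardsD1 x S; rewrite xS add1n in cS.
have [||T [TS cT hT]] := IH (S :\ x); try lia.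
exists T; split=> //; first by apply: subset_trans TS (subsetDl _ _).
rewrite (big_setD1 x xS) /=.
have h1 : #|S :\ x| * f x <= \sum_(y in S :\ x) f y.
  by rewrite -sum_nat_const; apply: leq_sum => y /setD1P[_ /xmin].
set m := #|S :\ x| in cS h1 hT; set F := \sum_(y in S :\ x) f y in h1 hT *.
set G := \sum_(y in T) f y in hT *.
rewrite cS; have [m0|m0] := posnP m; first by have -> : b = 0 by lia.
rewrite -(leq_pmul2l m0).
apply: leq_trans (_ : m.+1 * (b * F) <= _); last by nia.
by nia.
Qed.

Lemma blowup_in_sub (V : finType) (e e' : rel V) l : subrel e e' ->
  blowup_in e l -> blowup_in e' l.
Proof.
move=> sub [r [q [h1 h2 h3 h4]]]; exists r, q; split=> // j jl.
have [g1 g2 g3 g4] := h3 j jl; split=> //; last exact: sub_sorted g3.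
by elim: r (q j) g2 {h1 h2 h3 h4 g1 g3 g4} => [|a r IH] [|b s] //= /andP[/sub-> /IH->].
Qed.

(** * Reduction to almost regular graphs *)

Section Density.
Variables (V : finType) (e : rel V).
Hypotheses (e_sym : symmetric e) (e_irr : irreflexive e).

Definition restr (S : {set V}) : rel V := fun x y => [&& x \in S, y \in S & e x y].
Definition vol (S : {set V}) := \sum_(x in S) #|nb e x :&: S|.

Lemma restr_sym S : symmetric (restr S).
Proof. by move=> x y; rewrite /restr e_sym andbCA. Qed.
Lemma restr_irr S : irreflexive (restr S).
Proof. by move=> x; rewrite /restr e_irr !andbF. Qed.
Lemma nb_restr (S : {set V}) x : x \in S -> nb (restr S) x = nb e x :&: S.
Proof. by move=> xS; apply/setP => y; rewrite !inE /restr xS /= andbC. Qed.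

Lemma vol_le_sq S : vol S <= #|S| ^ 2.
Proof.
rewrite expnS expn1 -sum_nat_const; apply: leq_sum => x _.
exact/subset_leq_card/subsetIr.
Qed.

Lemma cross_sym (S T : {set V}) :
  \sum_(x in S) #|nb e x :&: T| = \sum_(y in T) #|nb e y :&: S|.
Proof.
have -> : \sum_(x in S) #|nb e x :&: T| = \sum_(x in S) #|[set y in T | e x y]|.
  by apply: eq_bigr => x _; apply: eq_card => y; rewrite !inE andbC.
rewrite sum_card_rel; apply: eq_bigr => y _; apply: eq_card => x.
by rewrite !inE andbC e_sym.
Qed.

Lemma vol_split (S B : {set V}) : B \subset S ->
  vol S <= vol (S :\: B) + 2 * \sum_(x in B) #|nb e x :&: S|.
Proof.
move=> BS; rewrite /vol (big_setID B) /= (setIidPr BS).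
have h : \sum_(x in S :\: B) #|nb e x :&: S| <=
    \sum_(x in S :\: B) #|nb e x :&: (S :\: B)| + \sum_(x in S :\: B) #|nb e x :&: B|.
  rewrite -big_split /=; apply: leq_sum => x _.
  apply: leq_trans (leq_card_setU _ _).1; apply: subset_leq_card.
  by apply/subsetP => y; rewrite !inE => /andP[-> ->]; case: (y \in B).
have : \sum_(x in S :\: B) #|nb e x :&: B| <= \sum_(x in B) #|nb e x :&: S|.
  rewrite cross_sym; apply: leq_sum => x _; apply: subset_leq_card.
  exact/setIS/subsetDl.
lia.
Qed.

Lemma vol_D1 (A : {set V}) x : x \in A -> vol A <= vol (A :\ x) + 2 * #|nb e x :&: A|.
Proof.
move=> xA; have := @vol_split A [set x]; rewrite sub1set xA big_set1; exact.
Qed.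

(* In a minimal counterexample S the set B of vertices of degree above [k E / s] meets fewer than
   half of the edges: otherwise B with a well-chosen set of [s / k] vertices is a denser, smaller
   counterexample. Removing B and then low-degree vertices leaves an almost regular graph. *)
Lemma blowup_free_vol l t C (S : {set V}) : ~ blowup_in e l ->
  8 * (4 * l + 4) * (192 * (16 * 4 ^ 4) ^ 4) + 4 * l + 8 <= t ->
  (4 ^ 4) ^ 4 + (16 * 32) ^ 7 + 16 ^ 7 * (324 * (l * (16 * t ^ 3))) <= C ->
  vol S ^ 7 <= C * #|S| ^ 10.
Proof.
(* [k] solves [k ^ 3 = 4 ^ 7 * 2 ^ 10]: when [B] meets most edges, passing to [2 * b] vertices loses
   [4 ^ 7] through [E <= 4 * EB] and [2 ^ 10] through the vertex count, and [b <= s / k] regains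
   [k ^ 3]. It is kept opaque so that its powers stay symbolic. *)
move=> nbl + + ; have [k kE] : exists k, k = 4 ^ 4 by exists (4 ^ 4).
have k0 : 0 < k by rewrite kE expn_gt0.
rewrite -kE => ht hC; have [n] := ubnP #|S|; elim: n S => // n IH S hS; rewrite ltnS in hS.
rewrite leqNgt; apply/negP => hE.
set s := #|S| in hS hE *; set E := vol S in hE *.
have s0 : 0 < s.
  rewrite lt0n; apply/eqP => s0; move: hE; rewrite /E /vol.
  by rewrite (cards0_eq s0) big_set0.
have E0 : 0 < E by rewrite lt0n; apply/eqP => h; rewrite h exp0n // in hE.
have sk : k <= s.
  (* The summand [k ^ 4] of [C] is spent here: [E <= s ^ 2] then forces [k <= s], which makes
     [b = s %/ k] positive. *)
  have h : E ^ 7 <= s ^ 14.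
    by rewrite (_ : 14 = 2 * 7) // expnM leq_exp2r //; exact: vol_le_sq.
  have : k ^ 4 * s ^ 10 < s ^ 4 * s ^ 10.
    rewrite -expnD; apply: leq_trans h; apply: leq_ltn_trans hE.
    rewrite leq_mul2r; apply/orP; right; apply: leq_trans hC.
    by rewrite -addnA leq_addr.
  by rewrite ltn_mul2r => /andP[_]; rewrite ltn_exp2r // => /ltnW.
pose B := [set x in S | k * E < #|nb e x :&: S| * s].
have BS : B \subset S by apply/subsetP => x; rewrite inE => /andP[].
have cB : k * #|B| <= s.
  rewrite -(leq_pmul2r E0).
  apply: leq_trans (_ : \sum_(x in B) #|nb e x :&: S| * s <= _).
    rewrite mulnAC mulnC -sum_nat_const; apply: leq_sum => x; rewrite inE => /andP[_ /ltnW//].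
  rewrite -big_distrl /= mulnC leq_mul2l; apply/orP; right.
  by rewrite /E /vol [leqRHS](big_setID B) /= (setIidPr BS) leq_addr.
have [hB|hB] := ltnP (2 * vol (S :\: B)) E.
  pose b := s %/ k; pose EB := \sum_(x in B) #|nb e x :&: S|.
  have b0 : 0 < b by rewrite divn_gt0.
  have kb : k * b <= s by rewrite mulnC leq_trunc_div.
  have EB4 : E <= 4 * EB by have := vol_split BS; rewrite -/E -/EB; lia.
  (* [T] consists of [b] vertices with the most neighbours in [B], so it keeps a share of at least
     [b / s] of the adjacencies between [S] and [B]. *)
  have [|T [TS cT hT]] := @heaviest_subset V (fun y => #|nb e y :&: B|) S b.
    exact: leq_div.
  have cBb : #|B| <= b by rewrite leq_divRL // mulnC.
  have [cBT volBT] : #|B :|: T| <= 2 * b /\ b * EB <= s * vol (B :|: T).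
    split; first by have := (leq_card_setU B T).1; lia.
    apply: leq_trans (_ : b * \sum_(y in S) #|nb e y :&: B| <= _).
      by rewrite /EB cross_sym.
    apply: leq_trans hT _; rewrite leq_mul2l; apply/orP; right.
    rewrite /vol [leqRHS](big_setID T) /= (setIidPr (subsetUr B T)).
    apply: leq_trans (leq_addr _ _); apply: leq_sum => y _.
    by apply/subset_leq_card/setIS; exact: subsetUl.
  have lt : #|B :|: T| < n.
    apply: leq_trans hS; apply: leq_ltn_trans cBT _.
    apply: leq_trans kb; rewrite ltn_mul2r b0.
    by rewrite kE !expnS; lia.
  have h := IH _ lt.
  have h2 : b ^ 7 * E ^ 7 <= (4 * s) ^ 7 * (C * (2 * b) ^ 10).
    apply: leq_trans (_ : (4 * s) ^ 7 * vol (B :|: T) ^ 7 <= _).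
      rewrite -!expnMn leq_exp2r //; apply: leq_trans (_ : b * (4 * EB) <= _).
        by rewrite leq_mul2l EB4 orbT.
      by rewrite mulnCA -mulnA leq_mul2l volBT orbT.
    rewrite leq_mul2l; apply/orP; right; apply: leq_trans h _.
    by rewrite leq_mul2l leq_exp2r // cBT orbT.
  have h3 : E ^ 7 <= C * s ^ 7 * (k * b) ^ 3.
    have b70 : 0 < b ^ 7 by rewrite expn_gt0 b0.
    rewrite -(leq_pmul2l b70); apply: leq_trans h2 _; apply/eq_leq.
    have e4 : 4 ^ 7 = 2 ^ 14 by rewrite -[14]/(2 * 7) expnM.
    rewrite !expnMn e4.
    have -> : k ^ 3 = 2 ^ 14 * 2 ^ 10.
      by rewrite kE -expnD -[14 + 10]/(2 * (4 * 3)) !expnM.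
    rewrite (_ : b ^ 10 = b ^ 7 * b ^ 3); last by rewrite -expnD.
    move: (2 ^ 14) (2 ^ 10) (s ^ 7) (b ^ 7) (b ^ 3) => x1 x2 x3 x4 x5; lia.
  suff : E ^ 7 <= C * s ^ 10 by rewrite leqNgt hE.
  apply: leq_trans h3 _; rewrite -mulnA leq_mul2l; apply/orP; right.
  by rewrite (_ : 10 = 7 + 3) // expnD leq_mul2l leq_exp2r // kb orbT.
pose A0 := S :\: B.
(* A minimal subset with this edge density has minimum degree at least [E / (8 * s)]: removing a
   vertex of smaller degree would preserve the density bound. *)
pose P (A : {set V}) := (A \subset A0) && (E * #|A| < 4 * s * vol A).
have PA0 : P A0.
  rewrite /P subxx /=; have : #|A0| <= s by apply/subset_leq_card/subsetDl.
  rewrite -/A0 in hB; nia.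
case: (@arg_minnP _ A0 P (fun A : {set V} => #|A|) PA0) => A /andP[AA0 hA] Amin.
have AS : A \subset S by apply: subset_trans AA0 (subsetDl _ _).
have cA0 : 0 < #|A|.
  rewrite card_gt0; apply/eqP => h; move: hA.
  by rewrite h cards0 /vol big_set0 !muln0.
have degA x : x \in A -> E <= 8 * s * #|nb e x :&: A|.
  move=> xA; have cA := cardsD1 x A; rewrite xA add1n in cA.
  have : ~~ P (A :\ x) by apply/negP => /Amin; lia.
  rewrite /P (subset_trans (subsetDl _ _) AA0) /= -leqNgt.
  have := vol_D1 xA; nia.
have degA2 x : x \in A -> s * #|nb e x :&: A| <= k * E.
  move=> xA; have : x \in S :\: B by apply: (subsetP AA0).
  rewrite !inE => /andP[h xS]; rewrite xS /= -leqNgt mulnC in h.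
  by apply: leq_trans h; rewrite leq_mul2l subset_leq_card ?orbT // setIS.
(* The second summand of [C] makes the average degree at least 512, whence [dl >= 32]. *)
have C16 : (16 * 32) ^ 7 <= C by apply: leq_trans hC; rewrite -addnA addnCA leq_addr.
have E512 : 16 * 32 * s <= E.
  rewrite -(@leq_exp2r _ _ 7) //; apply: leq_trans (ltnW hE).
  rewrite expnMn; apply: leq_mul => //.
  by rewrite leq_pexp2l.
pose dl := E %/ (8 * s).
have s80 : 0 < 8 * s by rewrite muln_gt0.
have dl32 : 32 <= dl by rewrite leq_divRL //; lia.
have Edl : E <= 16 * s * dl.
  have := ltn_ceil E s80; rewrite -/dl; nia.
have cAs : #|A| <= s by exact: subset_leq_card.
suff h : dl ^ 7 <= 324 * (l * (16 * t ^ 3)) * #|A| ^ 3.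
  suff : E ^ 7 <= C * s ^ 10 by rewrite leqNgt hE.
  apply: leq_trans (_ : (16 * s * dl) ^ 7 <= _); first by rewrite leq_exp2r.
  rewrite !expnMn (_ : 10 = 7 + 3) // expnD.
  apply: leq_trans (_ : 16 ^ 7 * s ^ 7 * (324 * (l * (16 * t ^ 3)) * s ^ 3) <= _).
    rewrite leq_mul2l; apply/orP; right; apply: leq_trans h _.
    by rewrite leq_mul2l leq_exp2r // cAs orbT.
  rewrite mulnACA -mulnA [s ^ 7 * _]mulnC mulnA mulnA.
  rewrite -mulnA [s ^ 3 * _]mulnC leq_mul2r; apply/orP; right.
  by apply: leq_trans hC; rewrite leq_addl.
apply: (@regular_blowup_free V (restr A) (restr_sym A) (restr_irr A) l (16 * k)
  (192 * (16 * k) ^ 4) t A dl) => //.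
- by move=> h; apply: nbl; apply: blowup_in_sub h => x y /and3P[].
- move=> x xA; rewrite nb_restr //; apply/andP; split.
    have := degA x xA; rewrite /dl; nia.
  rewrite -(leq_pmul2l s0); apply: leq_trans (degA2 x xA) _.
  by apply: leq_trans (leq_mul (leqnn k) Edl) _; apply/eq_leq; lia.
- by move=> x y /and3P[].
Qed.
End Density.

(** * Transfer to graphs on ['I_n] *)

Lemma adj_sym n (E : {set 'I_n * 'I_n}) : symmetric (adj E).
Proof. by move=> x y; rewrite /adj eq_sym orbC. Qed.

Lemma adj_irr n (E : {set 'I_n * 'I_n}) : irreflexive (adj E).
Proof. by move=> x; rewrite /adj eqxx. Qed.

Lemma blowup_in_contains n (E : {set 'I_n * 'I_n}) l :
  blowup_in (adj E) l -> contains E (@Tblowup l).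
Proof.
move=> [r [q [ur sr hq dq]]].
have x0 : 'I_n by case: r sr {ur hq}.
pose f (x : Tblowup_V l) := match x with
  | inl i => nth x0 r i | inr (j, k) => nth x0 (q j) k end.
have qP (j : 'I_l) := hq j (ltn_ord j).
have sq (j : 'I_l) : size (q j) = 4.
  by have [_ + _ _] := qP j; rewrite all2E sr => /andP[/eqP].
have mq (j : 'I_l) (k : 'I_4) : nth x0 (q j) k \in q j by rewrite mem_nth ?sq.
have mr (k : 'I_4) : nth x0 r k \in r by rewrite mem_nth ?sr.
have rq (i : 'I_4) (j : 'I_l) (k : 'I_4) : nth x0 r i != nth x0 (q j) k.
  by have [_ _ _ /hasPn/(_ _ (mq j k))] := qP j; apply: contra => /eqP <- /=.
have qq (j j' : 'I_l) (k k' : 'I_4) : nth x0 (q j) k = nth x0 (q j') k' -> j = j'.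
  move=> h; apply/val_inj/eqP; apply: contraT; rewrite neq_ltn => /orP[] lt.
    have /hasPn/(_ _ (mq j' k')) := dq j j' (introT andP (conj lt (ltn_ord j'))).
    by rewrite /= -h mq.
  have /hasPn/(_ _ (mq j k)) := dq j' j (introT andP (conj lt (ltn_ord j))).
  by rewrite /= h mq.
have leg (j : 'I_l) (k : 'I_4) : adj E (nth x0 r k) (nth x0 (q j) k).
  have [_ + _ _] := qP j; rewrite all2E => /andP[_ /allP].
  move/(_ (nth x0 r k, nth x0 (q j) k)); apply.
  by rewrite -nth_zip ?sr ?sq // mem_nth // size_zip sr sq.
have spine (j : 'I_l) (k k' : 'I_4) : k.+1 = k' ->
    adj E (nth x0 (q j) k) (nth x0 (q j) k').
  have [_ _ /(sortedP x0) h _] := qP j => kk; rewrite -kk; apply: h.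
  by rewrite sq kk ltn_ord.
apply/existsP; exists [ffun x => f x]; apply/andP; split.
  apply/injectiveP => -[i|[j k]] [i'|[j' k']]; rewrite !ffunE /=.
  - by move/eqP; rewrite nth_uniq ?sr // => /eqP/val_inj ->.
  - by move/eqP; rewrite (negPf (rq _ _ _)).
  - by move/eqP; rewrite eq_sym (negPf (rq _ _ _)).
  - move=> h; have ejj := qq _ _ _ _ h; move: h; rewrite -ejj => /eqP.
    by have [uq _ _ _] := qP j; rewrite nth_uniq ?sq // => /eqP/val_inj ->.
apply/forallP => x; apply/forallP => y; apply/implyP.
case: x y => [i|[j k]] [i'|[j' k']] //; rewrite !ffunE /=.
- by move/eqP ->.
- by move/eqP ->; rewrite adj_sym.
- case/andP => /eqP <- /orP[] /eqP h; first exact: spine.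
  by rewrite adj_sym; exact: spine.
Qed.

Theorem ex_upper l : exists C, forall n, @ex n (Tblowup_V l) (@Tblowup l) ^ 7 <= C * n ^ 10.
Proof.
set t := 8 * (4 * l + 4) * (192 * (16 * 4 ^ 4) ^ 4) + 4 * l + 8.
exists ((4 ^ 4) ^ 4 + (16 * 32) ^ 7 + 16 ^ 7 * (324 * (l * (16 * t ^ 3)))).
set C := (X in X * _) => n; rewrite /ex.
elim/big_ind: _ => [|x y hx hy|E hE].
- by rewrite exp0n.
- by rewrite /maxn; case: ifP.
have nbl : ~ blowup_in (adj E) l.
  by move=> h; move: hE; rewrite blowup_in_contains.
have := blowup_free_vol (@adj_sym _ E) (@adj_irr _ E) [set: 'I_n] nbl (leqnn _) (leqnn _).
rewrite cardsT card_ord; apply: leq_trans; rewrite leq_exp2r // /num_edges /vol.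
under eq_bigr do rewrite setIT -sum1_card.
rewrite pair_big_dep /= sum1dep_card; apply: subset_leq_card; apply/subsetP => -[x y].
by rewrite !inE /= => /andP[].
Qed.

Import all_algebra all_field ring mpoly.
Import GRing.Theory.

Section Algebraic.
Local Open Scope ring_scope.

(** * Nonsingular zeros of polynomial systems *)

Lemma mpoly_ring_ind (R : comNzRingType) k (Q : {mpoly R[k]} -> Prop) :
  (forall c, Q c%:MP) -> (forall i, Q 'X_i) ->
  (forall p q, Q p -> Q q -> Q (p + q)) -> (forall p q, Q p -> Q q -> Q (p * q)) ->
  forall p, Q p.
Proof.
move=> hC hX hD hM p; rewrite [p]mpolyE; apply: big_ind; [by rewrite -mpolyC0 | exact: hD | move=> m _].
rewrite -mul_mpolyC; apply: (hM) => //; rewrite mpolyXE_id.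
apply: big_ind; [by rewrite -mpolyC1 | exact: hM | move=> i _].
elim: (m i) => [|d IH]; first by rewrite expr0 -mpolyC1.
by rewrite exprS; apply: (hM).
Qed.

Section Arc.
Variables (F : fieldType) (k : nat).
Implicit Types (P : {mpoly F[k]}) (p w : 'I_k -> {poly F}).
Local Notation ev p := (mmap (@polyC F) p).

Lemma evC p c : ev p c%:MP = c%:P. Proof. exact: mmapC. Qed.
Lemma evX p i : ev p 'X_i = p i. Proof. by rewrite mmapX mmap1U. Qed.
Lemma evD p P Q : ev p (P + Q) = ev p P + ev p Q. Proof. exact: raddfD. Qed.
Lemma evM p P Q : ev p (P * Q) = ev p P * ev p Q. Proof. exact: rmorphM. Qed.

Lemma ev_taylor p w (y : {poly F}) P : exists r,
  ev (fun i => p i + y * w i) P =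
  ev p P + y * \sum_j w j * ev p P^`M(j) + y ^+ 2 * r.
Proof.
elim/mpoly_ring_ind: P => [c|i|P Q [r hP] [s hQ]|P Q [r hP] [s hQ]].
- exists 0; rewrite !evC big1 ?mulr0 ?addr0 // => j _.
  by rewrite mderivC raddf0 mulr0.
- exists 0; rewrite !evX mulr0 addr0 (bigD1 i) //= big1 => [|j ji].
    rewrite mderivX mnm1E eqxx scale1r (_ : (U_(i) - U_(i))%MM = 0%MM).
      by rewrite mpolyX0 rmorph1 mulr1 addr0.
    by apply/mnmP => j; rewrite mnmBE subnn mnm0E.
  by rewrite mderivX mnm1E eq_sym (negPf ji) scale0r raddf0 mulr0.
- exists (r + s); rewrite !evD hP hQ.
  have -> : \sum_j w j * ev p (P + Q)^`M(j) =
      \sum_j w j * ev p P^`M(j) + \sum_j w j * ev p Q^`M(j).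
    by rewrite -big_split /=; apply: eq_bigr => j _; rewrite mderivD evD mulrDr.
  by ring.
- set a := ev p P in hP *; set b := ev p Q in hQ *.
  set A := \sum_j _ in hP; set B := \sum_j _ in hQ.
  exists (r * b + s * a + A * B + y * (A * s + B * r) + y ^+ 2 * (r * s)).
  rewrite !evM hP hQ -/a -/b.
  have -> : \sum_j w j * ev p (P * Q)^`M(j) = A * b + a * B.
    rewrite /A /B big_distrl big_distrr -big_split /=; apply: eq_bigr => j _.
    by rewrite mderivM evD !evM -/a -/b; ring.
  by ring.
Qed.

Lemma ev_horner0 p P a : (forall i, (p i).[0] = a i) -> (ev p P).[0] = P.@[a].
Proof.
move=> h; elim/mpoly_ring_ind: P => [c|i|P Q hP hQ|P Q hP hQ].
- by rewrite evC hornerC mevalC.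
- by rewrite evX h mevalXU.
- by rewrite evD hornerD hP hQ mevalD.
- by rewrite evM hornerM hP hQ mevalM.
Qed.

Lemma horner0_factor (p : {poly F}) : p.[0] = 0 -> exists q, p = 'X * q.
Proof.
move=> h; have /factor_theorem[q ->] : root p 0 by apply/rootP.
by exists q; rewrite subr0 mulrC.
Qed.

(** Newton iteration, one coefficient at a time: correcting the arc by ['X^(L.+1)] times w, with J w
    = - r(0), cancels the next coefficient of the error, and the quadratic Taylor term has higher
    order. Truncation lets polynomials replace power series. *)
Lemma hensel_lift (P : 'I_k -> {mpoly F[k]}) (a : 'I_k -> F) (u : 'I_k -> {poly F}) L :
  (forall i, (P i).@[a] = 0) ->
  \matrix_(i, j) ((P i)^`M(j)).@[a] \in unitmx ->
  (forall i, (u i).[0] = 0) ->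
  exists p, (forall i, (p i).[0] = a i) /\
    forall i, exists r, ev p (P i) = u i + 'X^(L.+1) * r.
Proof.
move=> Pa0 Ju u0; elim: L => [|L [p [pa /fin_all_exists[r hr]]]].
  exists (fun i => (a i)%:P); split=> i; first by rewrite hornerC.
  have [|q hq] := @horner0_factor (ev (fun i => (a i)%:P) (P i) - u i).
    rewrite hornerD hornerN u0 subr0 (@ev_horner0 _ _ a) // => j.
    by rewrite hornerC.
  by exists q; rewrite expr1 -hq addrC subrK.
set J := \matrix_(i, j) _ in Ju.
pose w := invmx J *m \col_i - (r i).[0].
have hw i : \sum_j J i j * w j 0 = - (r i).[0].
  have : (J *m w) i 0 = (\col_i - (r i).[0]) i 0 by rewrite /w mulKVmx.
  by rewrite !mxE.
exists (fun i => p i + 'X^(L.+1) * (w i 0)%:P); split=> i.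
  by rewrite hornerD hornerM hornerXn expr0n /= mul0r addr0.
have [s hs] := ev_taylor p (fun i => (w i 0)%:P) 'X^(L.+1) (P i).
have [|q hq] := @horner0_factor (r i + \sum_j (w j 0)%:P * ev p (P i)^`M(j)).
  rewrite hornerD horner_sum -[(r i).[0]]opprK -hw addrC -[X in X - _](_ : \sum_j J i j * w j 0 = _) ?subrr //.
  by apply: eq_bigr => j _; rewrite hornerM hornerC (@ev_horner0 _ _ a) // mxE mulrC.
exists (q + 'X^L * s).
rewrite hs hr -addrA -addrA; congr (_ + _); rewrite addrA -mulrDr hq.
by rewrite [in RHS]exprSr -exprM muln2 -addnn addnS addSn !exprS exprD; ring.
Qed.
End Arc.

Section Degree.
Variables (F : fieldType) (k : nat).
Implicit Types P Q : {mpoly F[k]}.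

(** [msize] of a nonzero polynomial is its total degree plus one; with successors on the right the
    degree bounds add. *)
Lemma msizeM_leS P Q a b : (msize P <= a.+1)%N -> (msize Q <= b.+1)%N ->
  (msize (P * Q) <= (a + b).+1)%N.
Proof.
move=> hP hQ; have [->|P0] := eqVneq P 0; first by rewrite mul0r msize0.
have [->|Q0] := eqVneq Q 0; first by rewrite mulr0 msize0.
by rewrite msizeM // -subn1 leq_subLR add1n -addnS -addSn; exact: leq_add.
Qed.

Lemma msizeXn_leS P a n : (msize P <= a.+1)%N -> (msize (P ^+ n) <= (n * a).+1)%N.
Proof.
move=> h; elim: n => [|n IH]; first by rewrite expr0 msize1.
by rewrite exprS mulSn; apply: msizeM_leS.
Qed.

Lemma msize_prod_leS (I : finType) (R : I -> {mpoly F[k]}) (a : I -> nat) :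
  (forall i, msize (R i) <= (a i).+1)%N -> (msize (\prod_i R i) <= (\sum_i a i).+1)%N.
Proof.
move=> h; elim/big_rec2: _ => [|i d p _ IH]; first by rewrite msize1.
exact: msizeM_leS.
Qed.

Lemma msize_sum_leS (I : finType) (p : pred I) (R : I -> {mpoly F[k]}) a :
  (forall i, p i -> msize (R i) <= a)%N -> (msize (\sum_(i | p i) R i) <= a)%N.
Proof.
move=> h; elim/big_ind: _ => //; first by rewrite msize0.
move=> P Q hP hQ; apply: leq_trans (msizeD_le _ _) _; by rewrite geq_max hP hQ.
Qed.

Lemma card_bmultinom b : (#|{: 'X_{1..k < b}}| <= b ^ k)%N.
Proof.
have lt (m : 'X_{1..k < b}) i : ((m : 'X_{1..k}) i < b)%N.
  by apply: leq_ltn_trans (bmdeg m); rewrite mdegE (bigD1 i) //= leq_addr.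
pose f (m : 'X_{1..k < b}) := [ffun i : 'I_k => Ordinal (lt m i)].
have f_inj : injective f.
  move=> m m' /ffunP h; apply/val_inj/mnmP => i.
  by have := h i; rewrite !ffunE => /(congr1 val).
by have := leq_card f f_inj; rewrite card_ffun !card_ord.
Qed.

(** At most [b ^ k] monomials have degree below [b], so the coefficient matrix has more rows than
    columns. *)
Lemma mpoly_lin_dep (I : finType) (Q : I -> {mpoly F[k]}) b :
  (forall x, msize (Q x) <= b)%N -> (b ^ k < #|I|)%N ->
  exists lam : I -> F, (exists x, lam x != 0) /\ \sum_x lam x *: Q x = 0.
Proof.
move=> hQ hI; pose J : finType := 'X_{1..k < b}.
pose M := \matrix_(x < #|I|, m < #|J|) (Q (enum_val x))@_(val (enum_val m)).
have /rowV0Pn[v vK v0] : kermx M != 0.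
  rewrite -mxrank_eq0 mxrank_ker subn_eq0 -ltnNge.
  apply: leq_ltn_trans (rank_leq_col M) _.
  exact: leq_ltn_trans (card_bmultinom b) hI.
exists (fun x => v 0 (enum_rank x)); split.
  have [x hx] : exists x, v 0 x != 0.
    apply/existsP; apply: contraNT v0 => /existsPn h; apply/eqP/rowP => x.
    by rewrite mxE; apply/eqP; have := h x; rewrite negbK.
  by exists (enum_val x); rewrite enum_valK.
apply/mpolyP => m; rewrite mcoeff0 raddf_sum /=.
under eq_bigr do rewrite mcoeffZ.
have [mb|mb] := ltnP (mdeg m) b; last first.
  apply: big1 => x _; rewrite (memN_msupp_eq0 (p := Q x)) ?mulr0 //.
  by apply: msize_mdeg_ge; apply: leq_trans mb.
have /sub_kermxP/rowP/(_ (enum_rank (BMultinom mb : J))) := vK.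
rewrite !mxE => h; rewrite -[RHS]h (reindex_onto enum_val enum_rank) /=; last first.
  by move=> x _; rewrite enum_rankK.
rewrite (eq_bigl xpredT) => [|x]; last by rewrite enum_valK eqxx.
by apply: eq_bigr => x _; rewrite enum_valK mxE enum_rankK.
Qed.
End Degree.

(** Uniqueness of base-[A] expansions. It gives different products of powers of the P_i different
    orders along an arc where P_i is z^(A^i). *)
Lemma digits_inj k A (f g : 'I_k -> nat) :
  (forall i, f i < A)%N -> (forall i, g i < A)%N ->
  (\sum_i f i * A ^ i = \sum_i g i * A ^ i)%N -> f =1 g.
Proof.
elim: k f g => [|k IH] f g hf hg; first by move=> _ [].
have e (h : 'I_k.+1 -> nat) : (\sum_i h i * A ^ i = h ord0 + (\sum_(i < k) h (lift ord0 i) * A ^ i) * A)%N.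
  rewrite big_ord_recl expn0 muln1; congr (_ + _)%N; rewrite big_distrl /=.
  by apply: eq_bigr => i _; rewrite /bump /= add1n expnSr mulnA.
rewrite !e => h.
have A0 : (0 < A)%N by apply: leq_ltn_trans (hf ord0).
have h0 : f ord0 = g ord0.
  by have := congr1 (modn^~ A) h; rewrite ![(_ + _ * A)%N]addnC !modnMDl !modn_small.
move: h; rewrite h0 => /addnI /eqP; rewrite eqn_mul2r eqn0Ngt A0 /= => /eqP h1 i.
have [j ->|->] := unliftP ord0 i; last exact: h0.
exact: (IH (fun j => f (lift ord0 j)) (fun j => g (lift ord0 j))).
Qed.

Section ZeroBound.
Variables (F : finFieldType) (k D : nat) (P : 'I_k -> {mpoly F[k]}).
Hypothesis sP : forall i, (msize (P i) <= D.+1)%N.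
(** The products of all [P i ^ g i] with ['X_c ^ b], exponents below [A], number [A ^ k.+1] and have
    degree below [(k * D + 2) * A]. They are dependent once [A] exceeds [(k * D + 2) ^ k]. *)
Let A := ((k * D + 2) ^ k).+1.
Local Notation ev p := (mmap (@polyC F) p).

Lemma coef_eqmod (L : nat) (a b : {poly F}) :
  (exists r, a = b + 'X^(L.+1) * r) -> a`_L = b`_L.
Proof. by case=> r ->; rewrite coefD coefXnM ltnSn addr0. Qed.

Lemma eqmod_prod (L : nat) (I : finType) (a b : I -> {poly F}) (g : I -> nat) (c : {poly F}) :
  (forall i, exists r, a i = b i + 'X^L * r) ->
  exists r, \prod_i a i ^+ g i * c = \prod_i b i ^+ g i * c + 'X^L * r.
Proof.
move=> h; suff [r ->] : exists r, \prod_i a i ^+ g i = \prod_i b i ^+ g i + 'X^L * r.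
  by exists (r * c); ring.
have mul x y x' y' : (exists r, x = x' + 'X^L * r) -> (exists r, y = y' + 'X^L * r) ->
    exists r, x * y = x' * y' + 'X^L * r :> {poly F}.
  by move=> [r ->] [s ->]; exists (x' * s + r * y' + 'X^L * (r * s)); ring.
elim/big_rec2: _ => [|i x y _ IH]; first by exists 0; rewrite mulr0 addr0.
apply: (mul) IH; elim: (g i) => [|n IH]; first by exists 0; rewrite mulr0 addr0.
by rewrite !exprS; apply: (mul).
Qed.

(* The relation G(P, X_c) = 0 is evaluated along an arc on which P_i = z^(A^i);
   its lowest-order coefficient in z is a relation satisfied by the c-th coordinate
   of every nonsingular zero. *)
Lemma coordinate_poly c : exists R : {poly F}, [/\ R != 0, (size R <= A)%N &
  forall a : 'I_k -> F, (forall i, (P i).@[a] = 0) ->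
    \matrix_(i, j) ((P i)^`M(j)).@[a] \in unitmx -> root R (a c)].
Proof.
pose I : finType := ({ffun 'I_k -> 'I_A} * 'I_A)%type.
pose Q (x : I) := (\prod_i P i ^+ x.1 i) * 'X_c ^+ x.2.
have [x||lam [lam0 hlam]] := @mpoly_lin_dep F k I Q ((k * D + 2) * A)%N.
- have h1 : (msize (\prod_i P i ^+ x.1 i) <= (\sum_(i < k) (A.-1 * D)).+1)%N.
    apply: msize_prod_leS => i; apply: leq_trans (msizeXn_leS _ (sP i)) _.
    by rewrite ltnS leq_mul2r -ltnS prednK // ltn_ord orbT.
  have h2 : (msize ('X_c ^+ x.2 : {mpoly F[k]}) <= (x.2 * 1).+1)%N.
    by apply: msizeXn_leS; rewrite msizeX mdeg1.
  apply: leq_trans (msizeM_leS h1 h2) _; rewrite sum_nat_const card_ord.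
  have := ltn_ord x.2; have : (0 < A)%N by []. nia.
- by rewrite card_prod card_ffun !card_ord expnMn mulnC ltn_pmul2l ?expn_gt0.
pose kap (g : {ffun 'I_k -> 'I_A}) := (\sum_i g i * A ^ i)%N.
have kap_inj g g' : kap g = kap g' -> g = g'.
  move=> h; apply/ffunP => i; apply/val_inj.
  by apply: (@digits_inj k A (fun i => g i) (fun i => g' i)) h i => j; exact: ltn_ord.
have [x0 hx0] := lam0.
pose nz := [pred g | [exists b, lam (g, b) != 0]].
have nzx0 : nz x0.1 by apply/existsP; exists x0.2; case: x0 hx0.
(* [kap g] is the order of the product of the [P i ^ g i] along the arc. With [kap g] minimal, only
   the terms (g, b) survive at that order, and they add up to the value of [R] at [a c]. [R] does
   not depend on the zero [a]. *)
case: (arg_minnP kap nzx0) => g /existsP[b0 hb0] gmin.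
pose R := \poly_(b < A) lam (g, inord b).
exists R; split.
- apply: contraNneq hb0 => R0.
  have : R`_b0 = 0 by rewrite R0 coef0.
  by rewrite coef_poly ltn_ord inord_val => ->.
- exact: size_poly.
- move=> a Pa Ja.
have [|p [pa hp]] := @hensel_lift F k P a (fun i => 'X^(A ^ i)) (kap g) Pa Ja.
  by move=> i; rewrite hornerXn expr0n expn_eq0 /=.
have := congr1 (fun G => (ev p G)`_(kap g)) hlam.
rewrite raddf0 coef0 raddf_sum coef_sum.
rewrite (eq_bigr (fun x : I => lam (x.1, x.2) * ('X^(kap x.1) * p c ^+ x.2)`_(kap g))); last first.
  move=> x _; rewrite /= mmapZ coefCM -surjective_pairing; congr (_ * _).
  rewrite evM rmorphXn /= evX rmorph_prod /=.
  rewrite (eq_bigr (fun i => ev p (P i) ^+ x.1 i)); last by move=> i _; rewrite rmorphXn.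
  rewrite (coef_eqmod (eqmod_prod _ _ hp)).
  rewrite (_ : \prod_i _ = 'X^(kap x.1)) //.
  rewrite /kap -prodrXr; apply: eq_bigr => i _.
  by rewrite -exprM mulnC.
rewrite -(pair_bigA _ (fun g' (b : 'I_A) => lam (g', b) * ('X^(kap g') * p c ^+ b)`_(kap g))).
rewrite (bigD1 g) //= [X in _ + X]big1 ?addr0 => [h|g' g'g].
  apply/rootP; rewrite horner_poly -[RHS]h; apply: eq_bigr => b _.
  rewrite inord_val; congr (_ * _); rewrite coefXnM ltnn subnn.
  by rewrite -horner_coef0 horner_exp pa.
apply: big1 => b _; have [->|nz0] := eqVneq (lam (g', b)) 0; first by rewrite mul0r.
have : (kap g <= kap g')%N by apply: gmin; apply/existsP; exists b.
rewrite leq_eqVlt => /orP[/eqP/kap_inj gg|lt]; first by rewrite gg eqxx in g'g.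
by rewrite coefXnM lt mulr0.
Qed.

(** Each coordinate of such a zero is a root of a fixed polynomial with fewer than [A] roots. This
    is weaker than the Bezout bound [D ^ k], but it too is independent of [F], which is what
    matters. *)
Lemma nonsingular_zeros_bound (S : {set {ffun 'I_k -> F}}) :
  (forall a, a \in S -> (forall i, (P i).@[a] = 0) /\
     \matrix_(i, j) ((P i)^`M(j)).@[a] \in unitmx) -> (#|S| <= A ^ k)%N.
Proof.
move=> hS.
have [R hR] := fin_all_exists coordinate_poly.
apply: leq_trans (_ : #|family (fun c => [pred z | root (R c) z])| <= _)%N.
  apply: subset_leq_card; apply/subsetP => a /hS[a1 a2].
  by apply/familyP => c; have [_ _ h] := hR c; exact: h.
rewrite card_family foldrE big_map big_enum /=.
apply: leq_trans (_ : \prod_(c < k) A <= _)%N; last by rewrite prod_nat_const card_ord.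
apply: leq_prod => c _; have [R0 sR _] := hR c.
apply: leq_trans sR; rewrite cardE ltnW // max_poly_roots ?enum_uniq //.
by apply/allP => z; rewrite mem_enum.
Qed.
End ZeroBound.

(** * Random polynomials *)

(** By duality, adding combinations of the [b j] is injective on the product of the kernel with F^D.
    Independence is thus exploited by counting, without dimensions of subspaces. *)
Lemma card_common_kernel (F : finFieldType) (J I : finType) (D : {set I})
    (phi : I -> {ffun J -> F} -> F) (b : I -> {ffun J -> F}) :
  (forall i (c : {ffun J -> F}) (a : I -> F), phi i [ffun x => c x + \sum_(j in D) a j * b j x] =
      phi i c + \sum_(j in D) a j * phi i (b j)) ->
  {in D &, forall i j, phi i (b j) = (i == j)%:R} ->
  (#|[set c | [forall i in D, phi i c == 0%R]]| * #|F| ^ #|D| <= #|F| ^ #|J|)%N.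
Proof.
move=> phiD phib; set K := [set c | _].
pose P := [set a : {ffun I -> F} in pffun_on 0 (mem D) predT].
have -> : (#|F| ^ #|D| = #|P|)%N by rewrite cardsE card_pffun_on.
rewrite -card_ffun -cardsX.
pose f (x : {ffun J -> F} * {ffun I -> F}) :=
  [ffun y => x.1 y + \sum_(j in D) x.2 j * b j y].
rewrite -(card_in_imset (f := f)); first exact: max_card.
move=> [c a] [c' a']; rewrite !inE /= => /andP[/forall_inP cK aP] /andP[/forall_inP cK' aP'].
rewrite /f /= => h.
have aa' : a = a'.
  apply/ffunP => i; have [iD|iD] := boolP (i \in D).
    have : phi i (f (c, a)) = phi i (f (c', a')) by rewrite /f /= h.
    rewrite /f /= !phiD (eqP (cK i iD)) (eqP (cK' i iD)) !add0r.
    have s (d : {ffun I -> F}) : \sum_(j in D) d j * phi i (b j) = d i.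
      rewrite (bigD1 i) //= phib // eqxx mulr1 big1 ?addr0 // => j /andP[jD ji].
      by rewrite phib // eq_sym (negPf ji) mulr0.
    by rewrite !s.
  have off (d : {ffun I -> F}) : d \in pffun_on 0 (mem D) predT -> d i = 0.
    case/pffun_onP => /subsetP/(_ i) + _; rewrite unfold_in => hd.
    by apply/eqP; apply: contraNT iD => /hd.
  by rewrite !off.
by congr pair => //; apply/ffunP => y; have /ffunP/(_ y) := h; rewrite aa' !ffunE => /addIr.
Qed.

Section Jets.
Variables (F : finFieldType) (m D : nat).
Local Notation coefs := {ffun 'X_{1..m < D} -> F}.

Definition poly_of (c : coefs) : {mpoly F[m]} := \sum_(mu : 'X_{1..m < D}) c mu *: 'X_[mu].

Lemma poly_of_msize c : (msize (poly_of c) <= D)%N.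
Proof.
apply: msize_sum_leS => mu _; apply: leq_trans (msizeZ_le _ _) _.
by rewrite msizeX; exact: bmdeg.
Qed.

Lemma poly_of_comb (I : finType) (A : {set I}) (c : coefs) (a : I -> F) (b : I -> coefs) :
  poly_of [ffun mu => c mu + \sum_(j in A) a j * b j mu] = poly_of c + \sum_(j in A) a j *: poly_of (b j).
Proof.
have -> : \sum_(j in A) a j *: poly_of (b j) =
    \sum_(mu : 'X_{1..m < D}) (\sum_(j in A) a j * b j mu) *: 'X_[mu].
  under eq_bigr do rewrite scaler_sumr.
  rewrite exchange_big /=; apply: eq_bigr => mu _; rewrite scaler_suml.
  by apply: eq_bigr => j _; rewrite scalerA.
by rewrite -big_split /=; apply: eq_bigr => mu _; rewrite ffunE scalerDl.
Qed.

Lemma poly_of_surj (p : {mpoly F[m]}) : (msize p <= D)%N -> exists c, poly_of c = p.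
Proof.
move=> h; exists [ffun mu : 'X_{1..m < D} => p@_mu]; rewrite [RHS](mpolywE h).
by apply: eq_bigr => mu _; rewrite ffunE.
Qed.

Definition dder (p : {mpoly F[m]}) (z w : 'I_m -> F) : F := \sum_i w i * p^`M(i).@[z].

Lemma dderD p q z w : dder (p + q) z w = dder p z w + dder q z w.
Proof.
rewrite -big_split /=; apply: eq_bigr => i _.
by rewrite mderivD mevalD mulrDr.
Qed.

Lemma dderZ a p z w : dder (a *: p) z w = a * dder p z w.
Proof.
rewrite /dder big_distrr /=; apply: eq_bigr => i _.
by rewrite mderivZ mevalZ mulrCA.
Qed.

Lemma dder_sum (I : finType) (A : {set I}) (p : I -> {mpoly F[m]}) z w :
  dder (\sum_(j in A) p j) z w = \sum_(j in A) dder (p j) z w.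
Proof.
apply: (big_morph (fun p => dder p z w)) => [p1 p2|]; first exact: dderD.
by apply: big1 => i _; rewrite mderiv0 meval0 mulr0.
Qed.

Lemma dderM p q z w : dder (p * q) z w = dder p z w * q.@[z] + p.@[z] * dder q z w.
Proof.
rewrite /dder big_distrl big_distrr -big_split /=; apply: eq_bigr => i _.
by rewrite mderivM mevalD !mevalM; ring.
Qed.

Lemma dderX i z w : dder 'X_i z w = w i.
Proof.
rewrite /dder (bigD1 i) //= big1 => [|j ji].
  rewrite mderivX mnm1E eqxx scale1r (_ : (U_(i) - U_(i))%MM = 0%MM).
    by rewrite mpolyX0 meval1 mulr1 addr0.
  by apply/mnmP => j; rewrite mnmBE subnn mnm0E.
by rewrite mderivX mnm1E eq_sym (negPf ji) scale0r meval0 mulr0.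
Qed.

Lemma dderC c z w : dder c%:MP z w = 0.
Proof. by apply: big1 => i _; rewrite mderivC meval0 mulr0. Qed.

Variables (E : finType) (z w : E -> {ffun 'I_m -> F}).
Hypothesis z_inj : injective z.

(** A product over the other points of squared affine forms, each form 1 at [z e] and 0 at [z e'];
    the square kills the first derivatives too. *)
Lemma bump_poly e : exists R : {mpoly F[m]},
  [/\ (msize R <= (2 * #|E|).+1)%N, R.@[z e] = 1 &
      forall e', e' != e -> R.@[z e'] = 0 /\ forall v, dder R (z e') v = 0].
Proof.
have /fin_all_exists[T hT] : forall e', exists T : {mpoly F[m]},
    [/\ (msize T <= 2.+1)%N, T.@[z e] = 1 &
      e' != e -> T.@[z e'] = 0 /\ forall v, dder T (z e') v = 0].
  move=> e'; have [->|ne] := eqVneq e' e.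
    by exists 1; split; rewrite ?msize1 ?meval1.
  have [c hc] : exists c, z e c != z e' c.
    apply/existsP; apply: contraNT ne => /existsPn h; apply/eqP/z_inj/ffunP => c.
    by have := h c; rewrite negbK => /eqP.
  pose L := (z e c - z e' c)^-1 *: ('X_c - (z e' c)%:MP).
  have evL (x : 'I_m -> F) : L.@[x] = (z e c - z e' c)^-1 * (x c - z e' c).
    by rewrite mevalZ mevalB mevalXU mevalC.
  exists (L ^+ 2); split.
  - apply: (@msizeXn_leS _ _ L 1 2); apply: leq_trans (msizeZ_le _ _) _.
    apply: leq_trans (msizeD_le _ _) _; rewrite geq_max msizeX mdeg1 /= msizeN msizeC.
    by case: (_ != _).
  - by rewrite expr2 mevalM evL mulVf ?mulr1 // subr_eq0.
  - by move=> _; split=> [|v]; rewrite expr2 ?dderM ?mevalM evL subrr mulr0 ?mul0r ?mulr0 ?addr0.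
exists (\prod_e' T e'); split.
- apply: leq_trans (msize_prod_leS (a := fun=> 2) _) _; first by move=> e'; have [] := hT e'.
  by rewrite sum_nat_const mulnC.
- by rewrite rmorph_prod /= big1 // => e' _; have [] := hT e'.
- move=> e' ne; have [_ _ /(_ ne)[h1 h2]] := hT e'.
  split=> [|v]; rewrite (bigD1 e') //= ?mevalM ?dderM h1 ?h2 ?mul0r ?addr0 //.
Qed.

(** The bump is multiplied by an affine form in a coordinate where [w e] is nonzero. The form
    vanishes at [z e], so only its own derivative along [w e], normalized to 1, survives there. *)
Lemma dual_deriv e : [exists i, w e i != 0] -> exists b : {mpoly F[m]},
  [/\ (msize b <= (2 * #|E|).+2)%N, forall e', b.@[z e'] = 0 &
    forall e', dder b (z e') (w e') = (e' == e)%:R].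
Proof.
case/existsP => i wi; have [R [sR R1 R0]] := bump_poly e.
exists (R * ((w e i)^-1 *: ('X_i - (z e i)%:MP))); split.
- rewrite -[(2 * #|E|).+1]addn1; apply: msizeM_leS => //.
  apply: leq_trans (msizeZ_le _ _) _.
  apply: leq_trans (msizeD_le _ _) _; rewrite geq_max msizeX mdeg1 /= msizeN msizeC.
  by case: (_ != _).
- move=> e'; rewrite mevalM mevalZ mevalB mevalXU mevalC.
  by have [->|/R0[-> _]] := eqVneq e' e; rewrite ?subrr ?mulr0 ?mul0r.
- move=> e'; rewrite dderM dderZ -scaleN1r -[(-1 *: _)]mul_mpolyC.
  have [->|/R0[-> ->]] := eqVneq e' e; last by rewrite !mul0r addr0.
  rewrite dderD dderM !dderC dderX mevalZ mevalD mevalXU mevalM !mevalC R1.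
  by rewrite mulN1r subrr mulr0 mulr0 !mul0r mulr0 !addr0 mul1r add0r mulVf.
Qed.

(** The bump may have a nonzero derivative along [w e]; a multiple of the polynomial from
    [dual_deriv] removes it without changing values. If [w e] is zero there is nothing to remove. *)
Lemma dual_value e : exists b : {mpoly F[m]}, [/\ (msize b <= (2 * #|E|).+2)%N,
  forall e', b.@[z e'] = (e' == e)%:R & forall e', dder b (z e') (w e') = 0].
Proof.
have [R [sR R1 R0]] := bump_poly e.
have Rv e' : R.@[z e'] = (e' == e)%:R by have [->|/R0[]//] := eqVneq e' e.
have [/dual_deriv[b [sb b1 b2]]|w0] := boolP [exists i, w e i != 0]; last first.
  exists R; split=> //; first exact: leqW.
  move=> e'; have [->|/R0[]//] := eqVneq e' e.
  apply: big1 => i _; have := existsPn w0 i; rewrite negbK => /eqP ->; exact: mul0r.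
exists (R + (- dder R (z e) (w e)) *: b); split.
- apply: leq_trans (msizeD_le _ _) _; rewrite geq_max leqW //.
  exact: leq_trans (msizeZ_le _ _) sb.
- by move=> e'; rewrite mevalD mevalZ b1 mulr0 addr0.
- move=> e'; rewrite dderD dderZ b2; have [->|/R0[_ ->]] := eqVneq e' e.
    by rewrite mulr1 subrr.
  by rewrite mulr0 addr0.
Qed.

(** A derivative along the zero vector is no condition, so only nonzero [w e] enter the exponent.
    The dual polynomials have degree at most [2 * #|E| + 1], and the coefficient space must contain
    them. *)
Lemma card_vanishing_coefs : ((2 * #|E|).+2 <= D)%N ->
  (#|[set c : coefs | [forall e, ((poly_of c).@[z e] == 0%R) && (dder (poly_of c) (z e) (w e) == 0%R)]]|
    * #|F| ^ (#|E| + #|[set e | [exists i, w e i != 0%R]]|) <= #|{: coefs}|)%N.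
Proof.
move=> hD; pose Nz := [set e | [exists i, w e i != 0%R]].
pose I : finType := (E + E)%type.
pose A : {set I} := [set x | if x is inr e then e \in Nz else true].
have cA : #|A| = (#|E| + #|Nz|)%N.
  rewrite -!sum1_card big_sumType /=; congr (_ + _)%N; apply: eq_bigl => e; by rewrite !inE.
pose phi (x : I) (c : coefs) : F := match x with
  | inl e => (poly_of c).@[z e] | inr e => dder (poly_of c) (z e) (w e) end.
have /fin_all_exists[b hb] : forall x : I, exists b : coefs, x \in A ->
    forall y, y \in A -> phi y b = (y == x)%:R.
  case=> e; rewrite !inE.
    have [b [sb b1 b2]] := dual_value e.
    have [c hc] := poly_of_surj (leq_trans sb hD).
    by exists c => _ [] e' _ /=; rewrite hc ?b1 ?b2.
  have [we|we] := boolP [exists i, w e i != 0]; last by exists [ffun=> 0].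
  have [b [sb b1 b2]] := dual_deriv we.
  have [c hc] := poly_of_surj (leq_trans sb hD).
  by exists c => _ [] e' _ /=; rewrite hc ?b1 ?b2.
rewrite -/Nz -cA card_ffun.
apply: leq_trans (@card_common_kernel F 'X_{1..m < D} I A phi b _ _).
- rewrite leq_mul2r; apply/orP; right; apply: subset_leq_card; apply/subsetP => c.
  rewrite !inE => /forallP h; apply/forall_inP => -[e|e] _; by have /andP[] := h e.
- move=> i c a; case: i => e /=; rewrite poly_of_comb.
    rewrite mevalD [X in _ + X = _]raddf_sum /=; congr (_ + _).
    by apply: eq_bigr => j _; exact: mevalZ.
  by rewrite dderD dder_sum; congr (_ + _); apply: eq_bigr => j _; exact: dderZ.
- by move=> i j iA jA; exact: hb.
Qed.
End Jets.

(** * The random algebraic graph *)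

Section Substitution.
Variables (F : fieldType) (m k : nat) (l : 'I_m -> {mpoly F[k]}).
Local Notation subst := (mmap (@mpolyC k F) l).

Lemma subst_meval (f : {mpoly F[m]}) (a : 'I_k -> F) :
  (subst f).@[a] = f.@[fun i => (l i).@[a]].
Proof.
elim/mpoly_ring_ind: f => [c|i|p q hp hq|p q hp hq].
- by rewrite mmapC !mevalC.
- by rewrite mmapX mmap1U mevalXU.
- by rewrite raddfD /= !mevalD hp hq.
- by rewrite rmorphM /= !mevalM hp hq.
Qed.

Lemma subst_msize (f : {mpoly F[m]}) d : (forall i, msize (l i) <= 2)%N ->
  (msize f <= d.+1)%N -> (msize (subst f) <= d.+1)%N.
Proof.
move=> hl hf; rewrite [f](mpolywE hf) raddf_sum /=.
apply: msize_sum_leS => mu _; rewrite mmapZ mmapX mul_mpolyC.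
apply: leq_trans (msizeZ_le _ _) _.
apply: leq_trans (msize_prod_leS (a := fun i => (mu : 'X_{1..m}) i * 1)%N _) _.
  by move=> i; exact: msizeXn_leS.
under eq_bigr do rewrite muln1.
by rewrite -mdegE; exact: bmdeg.
Qed.
End Substitution.

Lemma subst_dder (F : finFieldType) m k (l : 'I_m -> {mpoly F[k]})
    (f : {mpoly F[m]}) (a b : 'I_k -> F) :
  dder (mmap (@mpolyC k F) l f) a b =
  dder f (fun i => (l i).@[a]) (fun i => dder (l i) a b).
Proof.
elim/mpoly_ring_ind: f => [c|i|p q hp hq|p q hp hq].
- by rewrite mmapC !dderC.
- by rewrite mmapX mmap1U dderX.
- by rewrite raddfD /= !dderD hp hq.
- by rewrite rmorphM /= !dderM hp hq !subst_meval.
Qed.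

Lemma dder_eq (F : finFieldType) m (f : {mpoly F[m]}) (a a' b b' : 'I_m -> F) :
  a =1 a' -> b =1 b' -> dder f a b = dder f a' b'.
Proof.
by move=> ha hb; apply: eq_bigr => i _; rewrite hb (meval_eq _ ha).
Qed.

Section Tree.
Variables (F : finFieldType).
Local Notation U := {ffun 'I_7 -> F}.
Local Notation slot := ('I_4 + 'I_4)%type.
Implicit Types (r v u : {ffun 'I_4 -> U}).

Definition join (x y : U) : {ffun 'I_(7 + 7) -> F} :=
  [ffun c => match split c with inl a => x a | inr a => y a end].

Definition o0 : 'I_4 := @Ordinal 4 0 isT.
Definition o1 : 'I_4 := @Ordinal 4 1 isT.
Definition o2 : 'I_4 := @Ordinal 4 2 isT.
Definition o3 : 'I_4 := @Ordinal 4 3 isT.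

(* The host is bipartite: the roots r_0, r_2 and the path vertices v_1, v_3 lie in X, the others in Y.
   Edges 0..3 are the legs, edges 4..6 the path; [xs] and [ys] give their X- and Y-ends. *)
Definition xs (e : 'I_7) : slot :=
  tnth [tuple inl o0; inr o1; inl o2; inr o3; inr o1; inr o1; inr o3] e.
Definition ys (e : 'I_7) : slot :=
  tnth [tuple inr o0; inl o1; inr o2; inl o3; inr o0; inr o2; inr o2] e.

Definition at_slot r v (sl : slot) : U := match sl with inl i => r i | inr i => v i end.
Definition pt r v (e : 'I_7) := join (at_slot r v (xs e)) (at_slot r v (ys e)).

Lemma join_inj x y x' y' : join x y = join x' y' -> x = x' /\ y = y'.
Proof.
move/ffunP => h; split; apply/ffunP => a.
  by have := h (lshift 7 a); rewrite !ffunE -[lshift _ _]/(unsplit (inl _ a)) unsplitK.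
by have := h (rshift 7 a); rewrite !ffunE -[rshift _ _]/(unsplit (inr _ a)) unsplitK.
Qed.

Variable d : nat.
Local Notation D := d.+1.
Local Notation coefs := {ffun 'X_{1..(7 + 7) < D} -> F}.
Variable om : {ffun 'I_4 -> coefs}.

Definition solves r v := [forall h, forall e, (poly_of (om h)).@[pt r v e] == 0].
(** The kernel of the Jacobian of the system in the path vertices alone: the roots are constants and
    move in direction 0. *)
Definition tangent r v : {set {ffun 'I_4 -> U}} :=
  [set u | [forall h, forall e, dder (poly_of (om h)) (pt r v e) (pt [ffun=> 0] u e) == 0]].

(** One index set serves twice: as (path vertex, coordinate) for the 28 unknowns and as (polynomial,
    edge) for the 28 equations. This makes the Jacobian square. *)
Let k := #|{: 'I_4 * 'I_7}|.
Let enc v : {ffun 'I_k -> F} := [ffun j => v (enum_val j).1 (enum_val j).2].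
Let slotp r (sl : slot) (a : 'I_7) : {mpoly F[k]} :=
  match sl with inl i => (r i a)%:MP | inr i => 'X_(enum_rank (i, a)) end.
Let lq r e (c : 'I_(7 + 7)) : {mpoly F[k]} :=
  match split c with inl a => slotp r (xs e) a | inr a => slotp r (ys e) a end.
Let sys r (i : 'I_k) : {mpoly F[k]} :=
  mmap (@mpolyC k F) (lq r (enum_val i).2) (poly_of (om (enum_val i).1)).

Let slotp_meval r v sl a : (slotp r sl a).@[enc v] = at_slot r v sl a.
Proof. by case: sl => i /=; rewrite ?mevalC // mevalXU ffunE enum_rankK. Qed.

Let slotp_dder r v u sl a : dder (slotp r sl a) (enc v) (enc u) = at_slot [ffun=> 0] u sl a.
Proof. by case: sl => i /=; rewrite ?dderC ?dderX ffunE ?ffunE // enum_rankK. Qed.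

Let lq_meval r v e c : (lq r e c).@[enc v] = pt r v e c.
Proof. by rewrite /lq ffunE; case: (split c) => a; rewrite slotp_meval. Qed.

Let lq_dder r v u e c : dder (lq r e c) (enc v) (enc u) = pt [ffun=> 0] u e c.
Proof. by rewrite /lq [RHS]ffunE; case: (split c) => a; rewrite slotp_dder. Qed.

Let sys_meval r v i : (sys r i).@[enc v] = (poly_of (om (enum_val i).1)).@[pt r v (enum_val i).2].
Proof. by rewrite subst_meval; apply: meval_eq => c; exact: lq_meval. Qed.

Let sys_dder r v u i : dder (sys r i) (enc v) (enc u) =
  dder (poly_of (om (enum_val i).1)) (pt r v (enum_val i).2) (pt [ffun=> 0] u (enum_val i).2).
Proof. by rewrite subst_dder; apply: dder_eq => c; [exact: lq_meval|exact: lq_dder]. Qed.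

Let enc_inj : injective enc.
Proof.
move=> v v' /ffunP h; apply/ffunP => i; apply/ffunP => a.
by have := h (enum_rank (i, a)); rewrite !ffunE enum_rankK.
Qed.

Let enc_surj (x : 'I_k -> F) : exists v, forall j, enc v j = x j.
Proof.
exists [ffun i => [ffun a => x (enum_rank (i, a))]] => j.
by rewrite !ffunE -surjective_pairing enum_valK.
Qed.

(** A singular Jacobian has a nonzero kernel vector, and its q multiples are all tangent. *)
Let sys_jac_unit r v : (#|tangent r v| < #|F|)%N ->
  \matrix_(i, j) ((sys r i)^`M(j)).@[enc v] \in unitmx.
Proof.
apply: contraTT => hJ; rewrite -leqNgt; set J := \matrix_(i, j) _ in hJ.
have /rowV0Pn[x xK x0] : kermx J^T != 0.
  by rewrite kermx_eq0 row_free_unit unitmx_tr.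
have [u0 hu0] := enc_surj (x 0).
have xJ i : \sum_j J i j * x 0 j = 0.
  have /sub_kermxP/rowP/(_ i) := xK; rewrite !mxE => hx; rewrite -[RHS]hx.
  by apply: eq_bigr => j _; rewrite [J^T _ _]mxE mulrC.
pose g (c : F) : {ffun 'I_4 -> U} := [ffun i => [ffun a => c * u0 i a]].
have encg c j : enc (g c) j = c * x 0 j by rewrite -hu0 !ffunE.
have gT c : g c \in tangent r v.
  rewrite inE; apply/forallP => h; apply/forallP => e.
  have := sys_dder r v (g c) (enum_rank (h, e)); rewrite enum_rankK /= => <-.
  rewrite /dder; under eq_bigr do rewrite encg -mulrA.
  rewrite -big_distrr /=; apply/eqP.
  have := xJ (enum_rank (h, e)) => hx; rewrite (_ : \sum_j _ = 0) ?mulr0 // -[RHS]hx.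
  by apply: eq_bigr => j _; rewrite mxE mulrC.
have [j xj] : exists j, x 0 j != 0.
  apply/existsP; apply: contraNT x0 => /existsPn h; apply/eqP/rowP => j.
  by rewrite mxE; apply/eqP; have := h j; rewrite negbK.
have g_inj : injective g.
  move=> c c' h; apply: (mulIf xj).
  by rewrite -!encg h.
rewrite -cardsT -(card_imset _ g_inj); apply: subset_leq_card.
by apply/subsetP => _ /imsetP[c _ ->].
Qed.

Lemma card_nonsingular_copies r :
  (#|[set v | solves r v && (#|tangent r v| < #|F|)]| <= ((28 * d + 2) ^ 28).+1 ^ 28)%N.
Proof.
have k28 : k = 28%N by rewrite /k card_prod !card_ord.
rewrite -(card_imset _ enc_inj) -[28%N]k28.
apply: (@nonsingular_zeros_bound F k d (sys r)) => [i|_ /imsetP[v + ->]].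
  apply: subst_msize; last exact: poly_of_msize.
  move=> c; rewrite /lq; case: (split c) => a; rewrite /slotp;
    [case: (xs _)|case: (ys _)] => j; rewrite ?msizeX ?mdeg1 // msizeC; by case: (_ != _).
rewrite inE => /andP[sv tv]; split; last exact: sys_jac_unit.
by move=> i; rewrite sys_meval; apply/eqP; have /forallP/(_ (enum_val i).1)/forallP := sv; apply.
Qed.
End Tree.

Lemma sum_card_relT (A B : finType) (R : A -> B -> bool) :
  (\sum_a #|[set b | R a b]| = \sum_b #|[set a | R a b]|)%N.
Proof.
have c (T : finType) (P : pred T) : #|[set x | P x]| = (\sum_(x | P x) 1)%N.
  by rewrite sum1dep_card.
under eq_bigr do rewrite c.
by rewrite (exchange_big_dep xpredT) //=; apply: eq_bigr => b _; rewrite c.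
Qed.

(** * Expected number of tuples of singular copies *)

Section Count.
Variables (F : finFieldType) (d s : nat).
Local Notation U := {ffun 'I_7 -> F}.
Local Notation coefs := {ffun 'X_{1..(7 + 7) < d.+1} -> F}.
Local Notation Om := {ffun 'I_4 -> coefs}.
Local Notation q := #|F|.
Implicit Types (r u : {ffun 'I_4 -> U}) (V W : {ffun 'I_s -> {ffun 'I_4 -> U}}) (om : Om).

Lemma pt_neq0 u (e : 'I_7) :
  [exists c, pt [ffun=> 0] u e c != 0] =
  (at_slot [ffun=> 0] u (xs e) != 0) || (at_slot [ffun=> 0] u (ys e) != 0).
Proof.
set x := at_slot _ _ (xs e); set y := at_slot _ _ (ys e).
rewrite -negb_and; apply/existsP/idP => [[c]|].
  apply: contra => /andP[/eqP x0 /eqP y0].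
  by rewrite ffunE -/x -/y x0 y0; case: (split c) => a; rewrite ffunE.
move=> hn; apply/existsP; apply: contraNT hn => /existsPn h.
have j0 c : join x y c = 0 by have := h c; rewrite negbK => /eqP.
have [-> ->] : x = 0 /\ y = 0.
  apply: join_inj; apply/ffunP => c; rewrite j0 ffunE.
  by case: (split c) => a; rewrite ffunE.
by rewrite eqxx.
Qed.

(* This is the balancedness of the rooted tree: every set of path vertices meets
   at least 7/4 as many edges. *)
Lemma tangent_balance u :
  (7 * #|[set i | u i != 0%R]| <= 4 * #|[set e | [exists c, pt [ffun=> 0%R] u e c != 0%R]]|)%N.
Proof.
rewrite -!sum1_card !(big_mkcond (fun i => i \in _)) /=.
under [X in (_ <= 4 * X)%N]eq_bigr do rewrite inE pt_neq0.
under eq_bigr do rewrite inE.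
rewrite !big_ord_recl !big_ord0 /=.
have z i : ([ffun=> 0] : {ffun 'I_4 -> U}) i = 0 by rewrite ffunE.
rewrite !z eqxx /= ?orbF.
have e0 : (ord0 : 'I_4) = o0 by apply/val_inj.
have e1 : lift ord0 (ord0 : 'I_3) = o1 by apply/val_inj.
have e2 : lift ord0 (lift ord0 (ord0 : 'I_2)) = o2 by apply/val_inj.
have e3 : lift ord0 (lift ord0 (lift ord0 (ord0 : 'I_1))) = o3 by apply/val_inj.
rewrite e1 e2 e3 e0.
by case: (u o0 != 0); case: (u o1 != 0); case: (u o2 != 0); case: (u o3 != 0).
Qed.

(** This is what independence requires: the edges of the [s] copies give distinct points of F^14. *)
Definition valid r V := injectiveb [ffun p : 'I_s * 'I_7 => pt r (V p.1) p.2].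
Definition bad om r V :=
  valid r V && [forall j, solves om r (V j) && (q <= #|tangent om r (V j)|)%N].
Definition flex r V W : {set Om} :=
  [set om | [forall j, solves om r (V j) && (W j \in tangent om r (V j))]].

Hypothesis hd : ((2 * (s * 7)).+2 <= d.+1)%N.

Lemma card_coefs4 : (#|{: coefs}| ^ 4 = #|{: Om}|)%N.
Proof. by rewrite [RHS]card_ffun card_ord. Qed.

(** Each of the four polynomials meets [7 * s] value conditions and one derivative condition per
    moving edge; by [tangent_balance] the latter together cost at least q^7 per moving path vertex.
    The extra factor [(q ^ 7) ^ (4 * s)] avoids division and turns the bound into a product over the
    entries of [W]. *)
Lemma card_flex r V W : valid r V ->
  (#|flex r V W| * q ^ (28 * s) * (q ^ 7) ^ (4 * s) <=
   #|{: Om}| * \prod_(j < s) \prod_(i < 4) (if W j i == 0%R then q ^ 7 else 1))%N.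
Proof.
move=> /injectiveP vrV.
pose z (p : 'I_s * 'I_7) := pt r (V p.1) p.2.
pose w (p : 'I_s * 'I_7) := pt [ffun=> 0] (W p.1) p.2.
have z_inj : injective z by move=> p p' h; apply: vrV; rewrite !ffunE.
have cE : #|{: 'I_s * 'I_7}| = (s * 7)%N by rewrite card_prod !card_ord.
have := @card_vanishing_coefs F (7 + 7) d.+1 _ z w z_inj.
rewrite cE => /(_ hd); set C' := [set c : coefs | _]; set Nz := [set e | _] => hC.
have h1 : (#|flex r V W| <= #|C'| ^ 4)%N.
  have := @card_ffun_on 'I_4 coefs (mem C'); rewrite card_ord => <-.
  apply: subset_leq_card.
  apply/subsetP => om; rewrite inE => /forallP h; apply/ffun_onP => a.
  rewrite inE; apply/forallP => -[j e]; have /andP[hs] := h j.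
  rewrite inE => /forallP/(_ a)/forallP/(_ e) ->; rewrite andbT.
  by have /forallP/(_ a)/forallP/(_ e) := hs.
have hN : (7 * \sum_(j < s) #|[set i | W j i != 0%R]| <= 4 * #|Nz|)%N.
  have -> : #|Nz| = (\sum_(j < s) #|[set e | [exists c, pt [ffun=> 0%R] (W j) e c != 0%R]]|)%N.
    under [RHS]eq_bigr do rewrite -sum1_card.
    rewrite pair_big_dep /= -sum1_card; apply: eq_bigl => -[j e].
    by rewrite !inE.
  by rewrite !big_distrr /=; apply: leq_sum => j _; exact: tangent_balance.
have hz : (\prod_(j < s) \prod_(i < 4) (if W j i == 0%R then q ^ 7 else 1) =
   (q ^ 7) ^ (\sum_(j < s) #|[set i | W j i == 0%R]|))%N.
  rewrite expn_sum; apply: eq_bigr => j _; rewrite -big_mkcond /= prod_nat_const.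
  by congr (_ ^ _)%N; apply: eq_card => i; rewrite inE.
have h4s : (4 * s = \sum_(j < s) #|[set i | W j i != 0%R]| + \sum_(j < s) #|[set i | W j i == 0%R]|)%N.
  rewrite -big_split /= (eq_bigr (fun=> 4%N)); first by rewrite sum_nat_const card_ord mulnC.
  move=> j _; rewrite -[RHS](card_ord 4) -(cardsC [set i | W j i == 0]) addnC.
  by congr (_ + _)%N; apply: eq_card => i; rewrite !inE.
rewrite hz h4s expnD mulnA leq_mul2r; apply/orP; right.
rewrite -card_coefs4.
apply: leq_trans (_ : (#|C'| * q ^ (s * 7 + #|Nz|)) ^ 4 <= _)%N; last by rewrite leq_exp2r.
rewrite expnMn -mulnA; apply: leq_mul => //.
rewrite -!expnM -expnD leq_exp2l; last exact: card_finNzRing_gt1.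
move: hN; lia.
Qed.

(* Each singular copy is counted at least q times by its tangent vectors W. *)
Lemma card_bad r V :
  (#|[set om | bad om r V]| * q ^ s * q ^ (28 * s) <= 16 ^ s * #|{: Om}|)%N.
Proof.
have [vrV|nv] := boolP (valid r V); last first.
  by rewrite (_ : [set om | bad om r V] = set0) ?cards0 //; apply/setP => om; rewrite !inE /bad (negPf nv).
set B := [set om | _].
have q0 : (0 < q)%N by apply/card_gt0P; exists 0.
have h1 : (#|B| * q ^ s <= \sum_W #|flex r V W|)%N.
  rewrite -sum_nat_const.
  apply: leq_trans (_ : \sum_(om in B) #|[set W in [set: {ffun 'I_s -> {ffun 'I_4 -> U}}] | om \in flex r V W]| <= _)%N.
    apply: leq_sum => om; rewrite inE => /andP[_ /forallP hb].
    apply: leq_trans (_ : #|family (fun j => mem (tangent om r (V j)))| <= _)%N.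
      rewrite card_family foldrE big_map big_enum /= -[s in leqLHS]card_ord -prod_nat_const.
      by apply: leq_prod => j _; have /andP[] := hb j.
    apply: subset_leq_card; apply/subsetP => W /familyP hW; rewrite !inE /=.
    by apply/forallP => j; have /andP[-> _] := hb j; rewrite hW.
  rewrite sum_card_rel (eq_bigl xpredT) => [|W]; last by rewrite inE.
  by apply: leq_sum => W _; apply: subset_leq_card; apply/subsetP => om; rewrite inE => /andP[].
have Q0 : (0 < (q ^ 7) ^ (4 * s))%N by rewrite !expn_gt0 q0.
rewrite -(leq_pmul2r Q0).
apply: leq_trans (_ : (\sum_W #|flex r V W|) * q ^ (28 * s) * (q ^ 7) ^ (4 * s) <= _)%N.
  by rewrite !leq_mul2r h1 !orbT.
rewrite !big_distrl /=.
apply: leq_trans (_ : \sum_(W : {ffun 'I_s -> {ffun 'I_4 -> U}})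
   #|{: Om}| * \prod_(j < s) \prod_(i < 4) (if W j i == 0%R then q ^ 7 else 1) <= _)%N.
  by apply: leq_sum => W _; exact: card_flex.
rewrite -big_distrr /=.
rewrite -(bigA_distr_bigA (fun j (u : {ffun 'I_4 -> U}) => \prod_(i < 4) (if u i == 0%R then q ^ 7 else 1))%N) /=.
rewrite [leqRHS]mulnAC [leqRHS]mulnC leq_mul2l; apply/orP; right.
have cU : #|{: U}| = (q ^ 7)%N by rewrite card_ffun card_ord.
(* An entry of [W j] contributes q^7 for the value 0 and 1 for each other value, less than 2 q^7 in
   all. Four entries per copy give [16 ^ s]. *)
have -> : (16 ^ s * (q ^ 7) ^ (4 * s) = \prod_(j < s) \prod_(i < 4) (2 * q ^ 7))%N.
  rewrite !prod_nat_const !card_ord expnM -expnMn; congr (_ ^ _)%N.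
  by rewrite expnMn.
apply: leq_prod => j _.
rewrite -(bigA_distr_bigA (fun i (x : U) => if x == 0%R then q ^ 7 else 1)%N) /=.
apply: leq_prod => i _; rewrite (bigD1 (0 : U)) //= eqxx mul2n -addnn leq_add2l.
rewrite (eq_bigr (fun=> 1%N)) => [|x /negPf -> //].
by rewrite sum1_card -cU max_card.
Qed.

(** There are q^28 root tuples, and the q^(28 s) choices of [V] cancel against the probability in
    [card_bad]: the expected number of bad pairs is at most 16^s q^(28-s). *)
Lemma sum_bad : ((\sum_om #|[set x : {ffun 'I_4 -> U} * {ffun 'I_s -> {ffun 'I_4 -> U}} | bad om x.1 x.2]|)
   * q ^ s <= 16 ^ s * q ^ 28 * #|{: Om}|)%N.
Proof.
have q0 : (0 < q)%N by apply/card_gt0P; exists 0.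
have h : (0 < q ^ (28 * s))%N by rewrite expn_gt0 q0.
rewrite -(leq_pmul2r h).
rewrite (sum_card_relT (fun om x => bad om x.1 x.2)).
rewrite !big_distrl /=.
apply: leq_trans (_ : \sum_(x : {ffun 'I_4 -> U} * {ffun 'I_s -> {ffun 'I_4 -> U}}) 16 ^ s * #|{: Om}| <= _)%N.
  by apply: leq_sum => x _; exact: card_bad.
have c1 : #|{: {ffun 'I_4 -> U}}| = (q ^ 28)%N.
  by rewrite !card_ffun !card_ord -expnM; congr expn.
have c2 : #|{: {ffun 'I_s -> {ffun 'I_4 -> U}}}| = (q ^ (28 * s))%N.
  by rewrite card_ffun c1 card_ord expnM.
rewrite sum_nat_const card_prod c1 c2.
move: (q ^ 28)%N (q ^ (28 * s))%N (16 ^ s)%N #|{: Om}| => a b c e.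
by rewrite mulnACA [(a * c)%N]mulnC [(b * e)%N]mulnC mulnA.
Qed.
End Count.

(** * Choice of the polynomials *)

Section Good.
Variables (F : finFieldType) (d s : nat).
Local Notation U := {ffun 'I_7 -> F}.
Local Notation coefs := {ffun 'X_{1..(7 + 7) < d.+1} -> F}.
Local Notation Om := {ffun 'I_4 -> coefs}.
Local Notation q := #|F|.
Implicit Types (om : Om) (x y : U).

Definition hadj om x y := [forall h, (poly_of (om h)).@[join x y] == 0].

(** Subtracting from a polynomial its value at [z] forgets only one element of [F]. *)
Lemma card_coefs_le_zero (z : {ffun 'I_(7 + 7) -> F}) :
  (#|{: coefs}| <= #|[set c : coefs | (poly_of c).@[z] == 0%R]| * q)%N.
Proof.
have [c0 hc0] : exists c : coefs, poly_of c = 1 by apply: poly_of_surj; rewrite msize1.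
pose sh (c : coefs) (a : F) : coefs := [ffun mu => c mu + \sum_(j in [set tt]) a * c0 mu].
have shE c a : poly_of (sh c a) = poly_of c + a *: 1.
  by rewrite (poly_of_comb [set tt] c (fun=> a) (fun=> c0)) big_set1 hc0.
rewrite -cardsT -cardsT -cardsX.
pose f (c : coefs) := (sh c (- (poly_of c).@[z]), (poly_of c).@[z]).
have f_inj : injective f.
  move=> c c' [+ h]; rewrite h => /ffunP hs; apply/ffunP => mu.
  by have := hs mu; rewrite !ffunE => /addIr.
rewrite -(card_imset _ f_inj); apply: subset_leq_card; apply/subsetP => _ /imsetP[c _ ->].
by rewrite !inE andbT shE mevalD mevalZ meval1 mulr1 subrr.
Qed.

Lemma card_hadj x y : (#|{: Om}| <= #|[set om | hadj om x y]| * q ^ 4)%N.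
Proof.
set Z := [set c : coefs | (poly_of c).@[join x y] == 0%R].
have -> : #|[set om | hadj om x y]| = (#|Z| ^ 4)%N.
  have := @card_ffun_on 'I_4 coefs (mem Z); rewrite card_ord => <-.
  apply: eq_card => om; rewrite inE; apply/forallP/ffun_onP => h a; have := h a; by rewrite inE.
by rewrite -expnMn -card_coefs4 leq_exp2r //; exact: card_coefs_le_zero.
Qed.

(** First moments only, without deletion: each bad pair gets the weight 2 q^14, which is at least
    [2 * ed om]. If no [om] worked, summing [key] would make the average of [bd] exceed q^-4 / 2,
    contrary to [sum_bad]. *)
Lemma exists_good : ((2 * (s * 7)).+2 <= d.+1)%N -> (2 * 16 ^ s * q ^ 42 <= q ^ (10 + s))%N ->
  exists2 om, (forall r V, ~~ @bad F d s om r V) &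
    (q ^ 10 <= 2 * #|[set p : U * U | hadj om p.1 p.2]|)%N.
Proof.
move=> hd hq.
pose ed om := #|[set p : U * U | hadj om p.1 p.2]|.
pose bd om := #|[set x : {ffun 'I_4 -> U} * {ffun 'I_s -> {ffun 'I_4 -> U}} | bad om x.1 x.2]|.
have [/existsP[om /andP[/eqP b0 h]]|/existsPn h] := boolP [exists om, (bd om == 0%N) && (q ^ 10 <= 2 * ed om)%N].
  exists om => // r V; apply/negP => hb.
  by have := card0_eq b0 (r, V); rewrite inE /= hb.
exfalso.
have q0 : (0 < q)%N by apply/card_gt0P; exists 0.
have cU : #|{: U * U}| = (q ^ 14)%N.
  by rewrite card_prod card_ffun card_ord -expnD.
have edle om : (ed om <= q ^ 14)%N by rewrite -cU; exact: max_card.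
have key om : ((2 * ed om).+1 <= q ^ 10 + 2 * q ^ 14 * bd om)%N.
  have := h om; rewrite negb_and -ltnNge => /orP[|lt]; last first.
    by apply: leq_trans lt _; exact: leq_addr.
  rewrite -lt0n => b1; apply: leq_trans (_ : q ^ 10 + 2 * ed om <= _)%N.
    by rewrite -[X in (X <= _)%N]add1n leq_add2r expn_gt0 q0.
  rewrite leq_add2l -mulnA leq_mul2l /=; apply: leq_trans (edle om) _.
  by rewrite leq_pmulr.
have sed : (q ^ 10 * #|{: Om}| <= \sum_om ed om)%N.
  have q40 : (0 < q ^ 4)%N by rewrite expn_gt0 q0.
  rewrite -(leq_pmul2r q40) /ed (sum_card_relT (fun om (p : U * U) => hadj om p.1 p.2)).
  rewrite mulnAC -expnD -cU big_distrl /= -sum_nat_const.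
  by apply: leq_sum => p _; exact: card_hadj.
have Om0 : (0 < #|{: Om}|)%N by apply/card_gt0P; exists [ffun=> [ffun=> 0]].
have s1 : (2 * \sum_om ed om + #|{: Om}| <= q ^ 10 * #|{: Om}| + 2 * q ^ 14 * \sum_om bd om)%N.
  rewrite big_distrr [X in (_ <= _ + X)%N]big_distrr /= mulnC -sum_nat_const -sum1_card -!big_split /=.
  by apply: leq_sum => om _; rewrite addn1; exact: key.
have s2 : (q ^ 10 * #|{: Om}| < 2 * q ^ 14 * \sum_om bd om)%N.
  move: s1 sed Om0; move: (q ^ 10)%N (q ^ 14)%N (\sum_om ed om)%N (\sum_om bd om)%N #|{: Om}|.
  move=> a b c e o; nia.
have qs0 : (0 < q ^ s)%N by rewrite expn_gt0 q0.
suff : (2 * q ^ 14 * (\sum_om bd om) * q ^ s <= q ^ 10 * #|{: Om}| * q ^ s)%N.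
  by rewrite leq_pmul2r // leqNgt s2.
rewrite -mulnA; apply: leq_trans (_ : 2 * q ^ 14 * (16 ^ s * q ^ 28 * #|{: Om}|) <= _)%N.
  by rewrite leq_mul2l; apply/orP; right; exact: sum_bad.
rewrite [leqRHS]mulnAC -expnD mulnA leq_mul2r; apply/orP; right.
apply: leq_trans hq; apply/eq_leq.
rewrite -[in RHS](_ : (14 + 28 = 42)%N) // expnD.
by move: (q ^ 14)%N (16 ^ s)%N (q ^ 28)%N => a b c; lia.
Qed.
End Good.

(** * The bipartite host contains no blow-up *)

Definition rev_copy l (t : Tblowup_V l) : Tblowup_V l :=
  match t with inl i => inl (rev_ord i) | inr (j, i) => inr (j, rev_ord i) end.

Lemma rev_copyK l : involutive (@rev_copy l).
Proof. by case=> [i|[j i]] /=; rewrite rev_ordK. Qed.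

Lemma rev_copy_hom l (t t' : Tblowup_V l) : Tblowup t t' -> Tblowup (rev_copy t) (rev_copy t').
Proof.
case: t t' => [i|[j i]] [i'|[j' i']] //=; rewrite ?(inj_eq rev_ord_inj) //.
case/andP => -> /= h; have := ltn_ord i; have := ltn_ord i'; lia.
Qed.

Section Host.
Variables (F : finFieldType) (d s : nat).
Local Notation U := {ffun 'I_7 -> F}.
Local Notation coefs := {ffun 'X_{1..(7 + 7) < d.+1} -> F}.
Variable om : {ffun 'I_4 -> coefs}.
Hypothesis om_good : forall r V, ~~ @bad F d s om r V.
Let B := (((28 * d + 2) ^ 28).+1 ^ 28)%N.

Definition host (a b : U + U) : bool :=
  match a, b with
  | inl x, inr y => hadj om x y | inr y, inl x => hadj om x y | _, _ => false end.
Definition left_side (a : U + U) := if a is inl _ then true else false.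
Definition point (a : U + U) : U := match a with inl x => x | inr y => y end.
Definition vert l (j : 'I_l) (sl : 'I_4 + 'I_4) : Tblowup_V l :=
  match sl with inl i => inl i | inr i => inr (j, i) end.

Lemma vert_edge l (j : 'I_l) e : Tblowup (vert j (xs e)) (vert j (ys e)).
Proof. by case: e => -[|[|[|[|[|[|[|m]]]]]]] //= h; rewrite /= ?eqxx. Qed.

Lemma vert_inj l (j j' : 'I_l) e e' : vert j (xs e) = vert j' (xs e') ->
  vert j (ys e) = vert j' (ys e') -> (j, e) = (j', e').
Proof.
suff H : vert j (xs e) = vert j' (xs e') -> vert j (ys e) = vert j' (ys e') ->
    j = j' /\ val e = val e' by move=> h1 h2; have [-> /val_inj ->] := H h1 h2.
case: e => -[|[|[|[|[|[|[|m]]]]]]] //= h; case: e' => -[|[|[|[|[|[|[|m']]]]]]] //= h';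
  rewrite /xs /ys /tnth /= /o0 /o1 /o2 /o3 => h1 h2; (discriminate || (split; congruence)).
Qed.

Lemma host_side a b : host a b -> left_side b = ~~ left_side a.
Proof. by case: a b => [x|x] [y|y]. Qed.

(** With r_1 on the left, connectedness fixes all sides as in [xs] and [ys]. Of at least [B + s]
    copies at most [B] are nonsingular zeros, and [s] singular ones would form a bad tuple. *)
Lemma left_root_free l (w : Tblowup_V l -> U + U) : (B + s <= l)%N ->
  injective w -> (forall t t', Tblowup t t' -> host (w t) (w t')) ->
  ~~ left_side (w (inl o0)).
Proof.
move=> hl w_inj w_hom; apply/negP => r0.
have sides (j : 'I_l) (e : 'I_7) : left_side (w (vert j (xs e))) /\ ~~ left_side (w (vert j (ys e))).
  have E e' := host_side (w_hom _ _ (vert_edge j e')).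
  have e0 := E (inord 0); have e1 := E (inord 1); have e2 := E (inord 2); have e3 := E (inord 3).
  have e4 := E (inord 4); have e5 := E (inord 5); have e6 := E (inord 6).
  move: e0 e1 e2 e3 e4 e5 e6; rewrite /xs /ys !(tnth_nth (inl o0)) !inordK //=.
  case: e => -[|[|[|[|[|[|[|m]]]]]]] //= _; rewrite ?r0;
    by do ?[case: (left_side _) => //].
pose r : {ffun 'I_4 -> U} := [ffun i => point (w (inl i))].
pose v (j : 'I_l) : {ffun 'I_4 -> U} := [ffun i => point (w (inr (j, i)))].
have at_vert j sl : at_slot r (v j) sl = point (w (vert j sl)).
  by case: sl => i; rewrite /at_slot ffunE.
have wx j e : w (vert j (xs e)) = inl (at_slot r (v j) (xs e)).
  by rewrite at_vert; have [+ _] := sides j e; case: (w _).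
have wy j e : w (vert j (ys e)) = inr (at_slot r (v j) (ys e)).
  by rewrite at_vert; have [_] := sides j e; case: (w _).
have sol j : solves om r (v j).
  apply/forallP => h; apply/forallP => e.
  by have := w_hom _ _ (vert_edge j e); rewrite wx wy => /forallP/(_ h).
have pt_inj j j' e e' : pt r (v j) e = pt r (v j') e' -> (j, e) = (j', e').
  by case/join_inj => h1 h2; apply: vert_inj; apply: w_inj; rewrite ?wx ?wy ?h1 ?h2.
have v_inj : injective v.
  by move=> j j' h; have := @pt_inj j j' ord0 ord0; rewrite h => /(_ erefl) [].
pose S := [set j | (#|F| <= #|tangent om r (v j)|)%N].
have cS : (s <= #|S|)%N.
  rewrite -(leq_add2l B); apply: leq_trans hl _.
  rewrite -[X in (X <= _)%N](card_ord l) -(cardsC S) addnC leq_add2r.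
  apply: leq_trans (card_nonsingular_copies om r).
  rewrite -(card_imset _ v_inj); apply: subset_leq_card; apply/subsetP => _ /imsetP[j + ->].
  by rewrite !inE -ltnNge sol => ->.
pose V : {ffun 'I_s -> {ffun 'I_4 -> U}} := [ffun i => v (enum_val (widen_ord cS i))].
apply/negP: (om_good r V); rewrite negbK; apply/andP; split.
  apply/injectiveP => -[i e] [i' e']; rewrite !ffunE /= => /pt_inj [] /enum_val_inj h ->.
  by congr pair; apply/val_inj; have := congr1 val h.
apply/forallP => i; rewrite ffunE sol /=.
by have := enum_valP (widen_ord cS i); rewrite inE.
Qed.

(** r_1 and r_4 are the ends of a path with five edges, so one of them lies on the left. Reversing
    the path of T exchanges them, so [left_root_free] excludes both cases. *)
Lemma host_free l (w : Tblowup_V l -> U + U) : (B + s <= l)%N -> (0 < l)%N ->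
  injective w -> ~ (forall t t', Tblowup t t' -> host (w t) (w t')).
Proof.
move=> hl l0 w_inj w_hom.
have h1 := left_root_free hl w_inj w_hom.
have h2 : ~~ left_side (w (rev_copy (inl o0))).
  apply: (left_root_free (w := w \o @rev_copy l)) => //.
    exact: inj_comp w_inj (inv_inj (@rev_copyK l)).
  by move=> t t' /rev_copy_hom /w_hom.
pose j : 'I_l := Ordinal l0.
have E t t' (h : Tblowup t t') := host_side (w_hom t t' h).
have e0 : Tblowup (inl o0 : Tblowup_V l) (inr (j, o0)) by [].
have e1 : Tblowup (inr (j, o0) : Tblowup_V l) (inr (j, o1)) by rewrite /= ?eqxx.
have e2 : Tblowup (inr (j, o1) : Tblowup_V l) (inr (j, o2)) by rewrite /= ?eqxx.
have e3 : Tblowup (inr (j, o2) : Tblowup_V l) (inr (j, o3)) by rewrite /= ?eqxx.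
have e4 : Tblowup (inr (j, o3) : Tblowup_V l) (inl o3) by [].
have r03 : rev_copy (inl o0 : Tblowup_V l) = inl o3 by rewrite /=; congr inl; apply/val_inj.
move: h2; rewrite r03 (E _ _ e4) (E _ _ e3) (E _ _ e2) (E _ _ e1) (E _ _ e0) !negbK.
by rewrite (negPf h1).
Qed.
End Host.

End Algebraic.

Lemma ex_host (F : finFieldType) (d s l n : nat)
    (om : {ffun 'I_4 -> {ffun 'X_{1..(7 + 7) < d.+1} -> F}}) :
  (forall r V, ~~ @bad F d s om r V) -> ((28 * d + 2) ^ 28).+1 ^ 28 + s <= l -> 0 < l ->
  2 * #|F| ^ 7 <= n ->
  #|[set p : {ffun 'I_7 -> F} * {ffun 'I_7 -> F} | hadj om p.1 p.2]| <=
    @ex n (Tblowup_V l) (@Tblowup l).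
Proof.
move=> om_good hl l0 hn.
pose U : finType := {ffun 'I_7 -> F}; pose W : finType := (U + U)%type.
have cW : #|W| <= n by rewrite card_sum card_ffun card_ord addnn -mul2n.
have [phi phi_inj] : exists phi : W -> 'I_n, injective phi.
  exists (fun a => widen_ord cW (enum_rank a)).
  by move=> a b /(congr1 val) /= h; apply/enum_rank_inj/val_inj.
pose E := [set (phi (inl p.1), phi (inr p.2)) | p in [set p : U * U | hadj om p.1 p.2]].
have EP x y : (x, y) \in E -> exists a b, [/\ x = phi a, y = phi b, host om a b & host om b a].
  by case/imsetP => -[a b]; rewrite inE /= => h [-> ->]; exists (inl a), (inr b).
have adjP x y : adj E x y -> exists a b, [/\ x = phi a, y = phi b & host om a b].
  case/andP => _ /orP[] /EP[a [b [-> -> h1 h2]]]; [exists a, b|exists b, a]; by split.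
have ncont : ~~ contains E (@Tblowup l).
  apply/negP => /existsP[f /andP[/injectiveP f_inj /forallP f_hom]].
  have hom t t' : Tblowup t t' -> adj E (f t) (f t').
    by move=> h; have /forallP/(_ t') := f_hom t; rewrite h.
  (* Vertices outside the image of [phi] are isolated, while T^l with [0 < l] has no isolated
     vertex; hence the embedding lifts to the host. *)
  have /fin_all_exists[w fw] : forall t, exists a, f t = phi a.
    case=> [i|[j i]].
      have /hom/adjP[a [b [h _ _]]] : Tblowup (inl i) (inr (Ordinal l0, i)) by rewrite /= eqxx.
      by exists a.
    have /hom/adjP[a [b [h _ _]]] : Tblowup (inr (j, i)) (inl i) by rewrite /= eqxx.
    by exists a.
  apply: (host_free om_good (w := w)) => // [t t' h|t t' /hom].
    by apply: f_inj; rewrite !fw h.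
  by rewrite !fw => /adjP[a [b [/phi_inj -> /phi_inj ->]]].
apply: (bigmax_sup E) ncont _.
pose g (p : U * U) := if phi (inl p.1) < phi (inr p.2) then (phi (inl p.1), phi (inr p.2))
   else (phi (inr p.2), phi (inl p.1)).
have g_inj : injective g.
  move=> [a b] [c e]; rewrite /g /=.
  by case: ifP => _; case: ifP => _ [/phi_inj h1 /phi_inj h2] //; case: h1 => ->; case: h2 => ->.
rewrite /num_edges -(card_imset _ g_inj); apply: subset_leq_card; apply/subsetP => _ /imsetP[[a b] + ->].
rewrite inE /= /g => h /=.
have ab : phi (inl a) != phi (inr b) by apply/eqP => /phi_inj.
have abE : (phi (inl a), phi (inr b)) \in E by apply/imsetP; exists (a, b).
have [lt|lt] := ltnP (phi (inl a)) (phi (inr b)); rewrite /= /adj.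
  by rewrite lt ab abE.
have ba : (phi (inr b) == phi (inl a)) = false by rewrite eq_sym (negPf ab).
by rewrite ltn_neqAle lt val_eqE ba abE orbT.
Qed.

Theorem ex_lower : exists l0, forall l, l0 < l -> exists K N, forall n, N <= n ->
  n ^ 10 <= K * @ex n (Tblowup_V l) (@Tblowup l) ^ 7.
Proof.
(* 33 is the least [s] with [42 < 10 + s], as [exists_good] needs for large q. [s] and [c] are kept
   opaque so that the huge powers stay symbolic. *)
have [s s33] : exists s, s = 33 by exists 33.
have [c cE] : exists c, c = 256 by exists 256.
pose d := (2 * (s * 7)).+1.
exists (((28 * d + 2) ^ 28).+1 ^ 28 + s) => l hl.
have l0 : 0 < l by apply: leq_ltn_trans hl.
exists (c ^ 10 * 2 ^ 7), (2 * (2 ^ 7) ^ (1 + 4 * s)) => n hn.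
(* q = 2^k is the largest power of 2 with [2 * q ^ 7 <= n], so n is at most 256 q^7. The threshold
   on n gives q at least 2^(1 + 4 s), which is 2 * 16^s. *)
pose k := trunc_log (2 ^ 7) (n %/ 2).
have n2 : (2 ^ 7) ^ (1 + 4 * s) <= n %/ 2 by rewrite leq_divRL // mulnC.
have n20 : 0 < n %/ 2 by apply: leq_trans n2; rewrite expn_gt0 expn_gt0.
have p1 : 1 < 2 ^ 7 by [].
have /andP[klo khi] := trunc_log_bounds p1 n20.
have ks : 1 + 4 * s <= k by rewrite -(trunc_expnK (1 + 4 * s) p1); exact: leq_trunc_log.
have k0 : 0 < k by apply: leq_trans ks.
have [F _ cF] := PrimePowerField (isT : prime 2) k0.
have hq : 2 * 16 ^ s * #|F| ^ 42 <= #|F| ^ (10 + s).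
  rewrite s33 (_ : 10 + 33 = 1 + 42) // expnD expn1 leq_mul2r cF; apply/orP; right.
  by rewrite (_ : 16 = 2 ^ 4) // -expnM -expnS -s33 leq_exp2l.
have [om om_good hom] := exists_good (leqnn (2 * (s * 7)).+2 : _ <= d.+1) hq.
have q7 : #|F| ^ 7 = (2 ^ 7) ^ k by rewrite cF -!expnM mulnC.
have hn2 : 2 * #|F| ^ 7 <= n.
  by rewrite q7; apply: leq_trans (leq_trunc_div n 2); rewrite mulnC leq_mul2r klo.
have hex := ex_host om_good (ltnW hl) l0 hn2.
have nq : n <= c * #|F| ^ 7.
  rewrite cE q7; apply: leq_trans (_ : 2 * (2 ^ 7) ^ k.+1 <= _); last first.
    by rewrite [(2 ^ 7) ^ k.+1]expnS mulnA leq_mul2r orbT.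
  by have := ltn_ceil n (isT : 0 < 2); rewrite mulnC => /ltnW/leq_trans; apply; rewrite leq_mul2l.
apply: leq_trans (_ : (c * #|F| ^ 7) ^ 10 <= _); first by rewrite leq_exp2r.
rewrite expnMn -mulnA leq_mul2l; apply/orP; right.
rewrite -expnMn -expnM (_ : 7 * 10 = 10 * 7) // expnM leq_exp2r //.
by apply: leq_trans hom _; rewrite leq_mul2l hex.
Qed.

(** * Passage to real exponents *)

Lemma INR_expn m n : INR (m ^ n)%N = pow (INR m) n.
Proof. by elim: n => [|n IH] //=; rewrite expnS -multE mult_INR IH. Qed.

Section RealBounds.
Local Open Scope R_scope.

Lemma leq_INR m n : (m <= n)%N -> INR m <= INR n.
Proof. by move=> h; apply: le_INR; exact/leP. Qed.

Lemma ex_upper_INR l : exists C : nat, forall n,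
  INR (@ex n (Tblowup_V l) (@Tblowup l)) ^ 7 <= INR C * INR n ^ 10.
Proof.
have [C hC] := ex_upper l; exists C => n.
by rewrite -!INR_expn -mult_INR; apply: leq_INR; exact: hC.
Qed.

Lemma ex_lower_INR : exists l0, forall l, (l > l0)%coq_nat -> exists K N : nat,
  forall n, (n >= N)%coq_nat ->
  INR n ^ 10 <= INR K * INR (@ex n (Tblowup_V l) (@Tblowup l)) ^ 7.
Proof.
have [l0 hl0] := ex_lower; exists l0 => l /ltP/hl0[K [N hN]]; exists K, N => n /leP/hN h.
by rewrite -!INR_expn -mult_INR; exact: leq_INR.
Qed.

End RealBounds.
End Blowup.

(** [K + 1] replaces the seventh root of [K]: [K <= (K + 1) ^ 7] for every [K >= 0]. *)
Lemma le_of_pow7_le (K a b : R) :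
  0 <= K -> 0 <= a -> 0 <= b -> a ^ 7 <= K * b ^ 7 -> a <= (K + 1) * b.
Proof.
intros hK ha hb h. apply Rnot_lt_le. intro hlt.
assert (h7 : ((K + 1) * b) ^ 7 < a ^ 7).
{ assert (hn : 0 <= (K + 1) * b) by (apply Rmult_le_pos; lra).
  assert (step : forall n, ((K + 1) * b) ^ S n < a ^ S n).
  { induction n as [|n IH]; [simpl; lra|].
    change (((K + 1) * b) * ((K + 1) * b) ^ S n < a * a ^ S n).
    apply Rmult_le_0_lt_compat; try assumption. apply pow_le; assumption. }
  exact (step 6%nat). }
rewrite Rpow_mult_distr in h7.
assert (hb7 : 0 <= b ^ 7) by (apply pow_le; assumption).
assert (hK7 : K <= (K + 1) ^ 7).
{ apply Rle_trans with ((K + 1) ^ 1); [simpl; lra|]. apply Rle_pow; [lra|auto with arith]. }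
assert (K * b ^ 7 <= (K + 1) ^ 7 * b ^ 7) by (apply Rmult_le_compat_r; assumption).
lra.
Qed.

Lemma Rpower_10_7_pow7 (x : R) : 0 < x -> Rpower x (10 / 7) ^ 7 = x ^ 10.
Proof.
intro hx. rewrite <- (Rpower_pow 7), Rpower_mult, <- (Rpower_pow 10); try apply exp_pos; auto.
f_equal. simpl; lra.
Qed.

(* ex(n, T^l_{4,7}) = Theta(n^{10/7}) for all l > l0 *)
Theorem theorem5p1 :
  exists l0 : nat, forall l : nat, (l > l0)%nat ->
    exists c1 c2 : R, 0 < c1 /\ 0 < c2 /\
    exists N : nat, forall n : nat, (n >= N)%nat ->
      c1 * Rpower (INR n) (10 / 7) <= INR (@ex n (Tblowup_V l) (@Tblowup l)) /\
      INR (@ex n (Tblowup_V l) (@Tblowup l)) <= c2 * Rpower (INR n) (10 / 7).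
Proof.
destruct Blowup.ex_lower_INR as [l0 hlow]. exists l0. intros l hl.
destruct (hlow l hl) as [K [N hN]]. destruct (Blowup.ex_upper_INR l) as [C hC].
assert (hK := pos_INR K). assert (hC0 := pos_INR C).
exists (/ (INR K + 1)), (INR C + 1).
split; [apply Rinv_0_lt_compat; lra|]. split; [lra|].
(* [Rpower] goes through a logarithm, so n has to be positive; hence [S N]. *)
exists (S N). intros n hn.
assert (hx : 0 < INR n).
{ apply lt_0_INR. apply Nat.lt_le_trans with (S N); [apply Nat.lt_0_succ|exact hn]. }
set (E := INR (@ex n (Tblowup_V l) (@Tblowup l))).
assert (hE : 0 <= E) by apply pos_INR.
assert (hy := Rpower_10_7_pow7 (INR n) hx).
set (y := Rpower (INR n) (10 / 7)) in *.
assert (y0 : 0 < y) by apply exp_pos.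
split.
- assert (h : y <= (INR K + 1) * E).
  { apply le_of_pow7_le; try lra. rewrite hy. apply hN.
    apply Nat.le_trans with (S N); [apply Nat.le_succ_diag_r|exact hn]. }
  apply (Rmult_le_reg_l (INR K + 1)); [lra|].
  rewrite <- Rmult_assoc, Rinv_r, Rmult_1_l; lra.
- apply le_of_pow7_le; try lra. rewrite hy. apply hC.
Qed.
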